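(* Let $n\ge 2$, $\sigma\in\mathfrak S_n$ and $1\le k<n$, and let $\zeta=\zeta(\sigma,k)$. Then there exists a permutation $\eta=\eta(\sigma,k)\in\mathfrak S_n$ such that $$G_\omega\,\hat\pi_{\omega\zeta}\,\pi_{\zeta^{-1}\sigma}=\sum_{\mu\in\mathfrak S_n,\ \sigma\le\mu\le\eta}(-1)^{\ell(\mu)-\ell(\sigma)}\,G_\mu ,$$ where $\le$ is the Bruhat order. In other words, the permutations occurring in the expansion form an interval $[\sigma,\eta]$ of the Bruhat order, each with coefficient $(-1)^{\ell(\mu)-\ell(\sigma)}$.
   Context: $\mathfrak S_n$ is the set of permutations of $\{1,\dots,n\}$, written as words $\sigma=\sigma_1\cdots\sigma_n$ with $\sigma_i=\sigma(i)$; products are compositions, $(\sigma\mu)(i)=\sigma(\mu(i))$. $s_i=(i,i+1)$. $\ell(\sigma)$ is the number of inversions of $\sigma$ (pairs $i<j$ with $\sigma_i>\sigma_j$), equal to the length of a reduced decomposition of $\sigma$ as a product of the $s_i$. $\omega=n(n-1)\cdots 1$. Bruhat order: $\sigma\le\mu$ iff a reduced decomposition of $\sigma$ is a subword of a reduced decomposition of $\mu$. Work in the ring of Laurent polynomials in $x_1,\dots,x_n$ with coefficients Laurent polynomials in $y_1,\dots,y_n$. For $1\le i<n$, the isobaric divided difference $\pi_i$ acts on the right by $f\pi_i=\dfrac{x_if-x_{i+1}f^{s_i}}{x_i-x_{i+1}}$, where $f^{s_i}$ is $f$ with $x_i,x_{i+1}$ exchanged, and $\hat\pi_i:=\pi_i-1$.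 For $\sigma$ with reduced decomposition $s_{i_1}\cdots s_{i_r}$ put $\pi_\sigma=\pi_{i_1}\cdots\pi_{i_r}$ and $\hat\pi_\sigma=\hat\pi_{i_1}\cdots\hat\pi_{i_r}$ (operators applied successively left to right; independent of the reduced decomposition). The double Grothendieck polynomials are $G_\omega=\prod_{i=1}^{n-1}\prod_{j=1}^{n-i}\bigl(1-\frac{y_j}{x_i}\bigr)$ and $G_\sigma:=G_\omega\pi_{\omega\sigma}$ for $\sigma\in\mathfrak S_n$. For $1\le k<n$, $\zeta(\sigma,k)$ is the permutation whose first $k$ letters are $\sigma_1,\dots,\sigma_k$ in decreasing order and whose last $n-k$ letters are $\sigma_{k+1},\dots,\sigma_n$ in decreasing order. *)

(* Defs.v *)
From HB Require Import structures.
From mathcomp Require Import all_boot all_order all_algebra all_fingroup.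
From mathcomp Require Import generic_quotient boolp.
From mathcomp.multinomials Require Import mpoly.

Set Implicit Arguments.
Unset Strict Implicit.
Unset Printing Implicit Defensive.

Import Order.TTheory GRing.Theory Num.Theory.
Local Open Scope ring_scope.

(* Letters and indices are numbered from 0: the element                       *)
(* i : 'I_n stands for the letter i + 1, and i : 'I_n.-1 for the index i + 1  *)
(* of the simple transposition exchanging i + 1 and i + 2.                    *)

(* MathComp multiplies permutations in diagrammatic order,                    *)
(* (s * t)%g i = t (s i); here (s ** t) i = s (t i).                          *)
Definition pcomp n (s t : 'S_n) : 'S_n := (t * s)%g.
Notation "s ** t" := (pcomp s t) (at level 40, left associativity).

Definition ell n (s : 'S_n) : nat :=
  #|[set p : 'I_n * 'I_n | (p.1 < p.2)%N && (s p.2 < s p.1)%N]|.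

Definition omega n : 'S_n := perm (@rev_ord_inj n).

Lemma lo_subproof n (i : 'I_n.-1) : (i < n)%N.
Proof. by case: n i => [|n] [i] //= /ltnW. Qed.

Lemma hi_subproof n (i : 'I_n.-1) : (i.+1 < n)%N.
Proof. by case: n i => [|n] [i]. Qed.

Definition lo n (i : 'I_n.-1) : 'I_n := Ordinal (lo_subproof i).
Definition hi n (i : 'I_n.-1) : 'I_n := Ordinal (hi_subproof i).

Definition simple n (i : 'I_n.-1) : 'S_n := tperm (lo i) (hi i).

Definition wprod n (w : seq 'I_n.-1) : 'S_n :=
  foldr (fun i s => simple i ** s) 1%g w.

Definition reduced n (s : 'S_n) (w : seq 'I_n.-1) : Prop :=
  wprod w = s /\
  forall w' : seq 'I_n.-1, wprod w' = s -> (size w <= size w')%N.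

Definition bruhat n (s m : 'S_n) : Prop :=
  exists w w' : seq 'I_n.-1, [/\ reduced s w, reduced m w' & subseq w w'].

Lemma wprod_cat n (w w' : seq 'I_n.-1) : wprod (w ++ w') = wprod w ** wprod w'.
Proof.
elim: w => [|i w IHw] /=; first by rewrite /pcomp mulg1.
by rewrite IHw /pcomp mulgA.
Qed.

Lemma wprod_tperm n (x y : 'I_n) : exists w, wprod w = tperm x y.
Proof.
wlog le_xy : x y / (x <= y)%N.
  by move=> H; case/orP: (leq_total x y) => /H // [w Hw]; exists w;
     rewrite Hw tpermC.
have [d] := ubnP (y - x); elim: d x y le_xy => // d IHd x y le_xy lt_d.
have [->|ne_xy] := eqVneq x y; first by exists [::]; rewrite tperm1.
have lt_xy : (x < y)%N by rewrite ltn_neqAle le_xy andbT.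
have y_gt0 : (0 < y)%N by apply: leq_ltn_trans lt_xy.
have lt_i : (y.-1 < n.-1)%N by rewrite -ltnS !prednK // (leq_trans _ (ltn_ord y)).
pose i := Ordinal lt_i.
have hiE : hi i = y by apply: val_inj; rewrite /= prednK.
have [xi|nxi] := eqVneq x (lo i).
  by exists [:: i]; rewrite /= /pcomp mul1g /simple hiE xi.
have le_xi : (x <= lo i)%N by rewrite -ltnS /= prednK.
have lt_id : (lo i - x < d)%N.
  rewrite -ltnS; apply: leq_trans lt_d; rewrite ltnS.
  by rewrite -(prednK y_gt0) subSn.
have [w Hw] := IHd x (lo i) le_xi lt_id.
exists (i :: (w ++ [:: i])); rewrite /= wprod_cat Hw /pcomp /= /pcomp mul1g.
have -> : (simple i * tperm x (lo i) * simple i = tperm x (lo i) ^ simple i)%g.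
  by rewrite /conjg {2}/simple tpermV mulgA.
rewrite tpermJ.
by rewrite /simple tpermL hiE tpermD // eq_sym.
Qed.

Lemma exists_reduced n (s : 'S_n) : exists w, reduced s w.
Proof.
have [w Hw] : exists w, wprod w = s.
  have [ts -> _] := prod_tpermP s.
  elim: ts => [|t ts [w IHw]]; first by exists [::]; rewrite big_nil.
  have [u Hu] := wprod_tperm t.1 t.2.
  by exists (w ++ u); rewrite wprod_cat IHw Hu big_cons.
have ex_k : exists k, `[< exists2 w, wprod w = s & size w = k >].
  by exists (size w); apply/asboolP; exists w.
case: (ex_minnP ex_k) => k /asboolP [v Hv <-] min_v.
by exists v; split=> // w' Hw'; apply: min_v; apply/asboolP; exists w'.
Qed.

Definition redword n (s : 'S_n) : seq 'I_n.-1 := projT1 (cid (exists_reduced s)).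

Definition zeta_word n (s : 'S_n) (k : nat) : seq 'I_n :=
  let letters := [seq s i | i <- enum 'I_n] in
  let decreasing (a b : 'I_n) := (b <= a)%N in
  sort decreasing (take k letters) ++ sort decreasing (drop k letters).

Lemma zeta_subproof n (s : 'S_n) k :
  injective (fun i : 'I_n => nth i (zeta_word s k) i).
Proof.
have pE : perm_eq (zeta_word s k) [seq s i | i <- enum 'I_n].
  rewrite -[X in perm_eq _ X](cat_take_drop k).
  by rewrite perm_cat // perm_sort.
have sz : size (zeta_word s k) = n.
  by rewrite (perm_size pE) size_map size_enum_ord.
have uz : uniq (zeta_word s k).
  by rewrite (perm_uniq pE) map_inj_uniq ?enum_uniq //; apply: perm_inj.
move=> i j /eqP; rewrite (set_nth_default i j) ?sz //.
by rewrite nth_uniq ?sz // => /eqP/val_inj.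
Qed.

Definition zeta n (s : 'S_n) (k : nat) : 'S_n := perm (@zeta_subproof n s k).

(* The operators act on rational functions in the x_i with coefficients in an *)
(* integral domain K.  With K = yfrac n below, Laurent polynomials in the x_i *)
(* and y_j form a subring of xfrac K n, on which these are the usual          *)
(* operators: the formula is the same, and dividing by x_i - x_(i+1) in the   *)
(* field gives the exact quotient.                                            *)
Notation xfrac K n := {fraction {mpoly K[n]}}.

Definition xvar (K : idomainType) n (i : 'I_n) : xfrac K n :=
  FracField.tofrac ('X_i : {mpoly K[n]}).

(* f^(s_i), computed on the representative p / q of f; it does not depend on  *)
(* the representative by xswap_frac.                                          *)
Definition xswap (K : idomainType) n (i : 'I_n.-1) (f : xfrac K n) : xfrac K n :=
  FracField.tofrac (msym (simple i) (frac (repr f)).1)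
    / FracField.tofrac (msym (simple i) (frac (repr f)).2).

Lemma frac_repr (R : idomainType) (f : {fraction R}) :
  f = FracField.tofrac (frac (repr f)).1 / FracField.tofrac (frac (repr f)).2.
Proof.
have d0 := denom_ratioP (repr f).
have fr0 : FracField.tofrac (frac (repr f)).2 != 0 by rewrite tofrac_eq0.
apply: (canRL (mulfK fr0)).
rewrite -{1}[f]reprK; unlock FracField.tofrac.
rewrite -[LHS]FracField.pi_mul.
apply/eqP; rewrite FracField.equivf_def /FracField.mulf.
by rewrite !numden_Ratio ?oner_eq0 ?mulr1 ?mulf_neq0 ?oner_eq0 // mulrC.
Qed.

Lemma xswap_frac (K : idomainType) n (i : 'I_n.-1) (p q : {mpoly K[n]}) :
  q != 0 ->
  xswap i (FracField.tofrac p / FracField.tofrac q)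
    = FracField.tofrac (msym (simple i) p) / FracField.tofrac (msym (simple i) q).
Proof.
move=> q0; rewrite /xswap.
have msym_neq0 (r : {mpoly K[n]}) : r != 0 -> msym (simple i) r != 0.
  apply: contra => /eqP r0; apply/eqP/(@inj_msym _ _ (simple i)).
  by rewrite r0 msym0.
have := frac_repr (FracField.tofrac p / FracField.tofrac q).
have := denom_ratioP (repr (FracField.tofrac p / FracField.tofrac q)).
move: (repr _) => [[a b] /= _] b0 /eqP.
rewrite eqr_div ?tofrac_eq0 // -!tofracM tofrac_eq => /eqP E.
apply/eqP; rewrite eqr_div ?tofrac_eq0 ?msym_neq0 //.
by rewrite -!tofracM tofrac_eq -!msymM E.
Qed.

Definition isob (K : idomainType) n (i : 'I_n.-1) (f : xfrac K n) : xfrac K n :=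
  (xvar K (lo i) * f - xvar K (hi i) * xswap i f)
    / (xvar K (lo i) - xvar K (hi i)).

Definition isobhat (K : idomainType) n (i : 'I_n.-1) (f : xfrac K n) :
  xfrac K n := isob i f - f.

(* The operators act on the right: f pi_s is pi_ s f, and the letters of a    *)
(* reduced decomposition are applied to f from left to right.                 *)
Definition pi_ (K : idomainType) n (s : 'S_n) (f : xfrac K n) : xfrac K n :=
  foldl (fun g i => isob i g) f (redword s).

Definition pihat_ (K : idomainType) n (s : 'S_n) (f : xfrac K n) : xfrac K n :=
  foldl (fun g i => isobhat i g) f (redword s).

Notation yfrac n := {fraction {mpoly int[n]}}.

Definition yvar n (j : 'I_n) : yfrac n :=
  FracField.tofrac ('X_j : {mpoly int[n]}).

Definition yconst n (c : yfrac n) : xfrac (yfrac n) n :=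
  FracField.tofrac (c%:MP_[n]).

(* The index ranges 1 <= i <= n - 1, 1 <= j <= n - i amount to i + j <= n;    *)
(* i.+1 and j.+1 are the indices counted from 1.                              *)
Definition Gomega n : xfrac (yfrac n) n :=
  \prod_(i < n) \prod_(j < n | (i.+1 + j.+1 <= n)%N)
    (1 - yconst (yvar j) / xvar (yfrac n) i).

Definition G n (s : 'S_n) : xfrac (yfrac n) n :=
  pi_ (omega n ** s) (Gomega n).

(* Main.v *)
(** Write [m = omega ** sigma = a ** b] with [a = omega ** zeta], which is
    increasing on the first [k] and on the last [n - k] positions, and with
    [b = zeta^-1 ** sigma], which permutes each of these two blocks.  Let
    [min_s u] be the smaller of [u] and [s ** u].  For a reduced word
    [s_1 ... s_r] of [a], a one-line induction on [r] gives
    [f pihat_a pi_b = sum of (-1)^(ell m - ell u) f pi_u] over the fiber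
    [F = {u | min_(s_r) (... (min_(s_1) u)) = b}].  By the lifting property the
    maps [min_s] are monotone for the Bruhat order, so [F] is an interval as
    soon as it has a least and a greatest element; the greatest one is [m].

    For the least one, read the elements of [F] as walks starting at [b]: at
    each letter [s_x], where the positions of the values [x] and [x + 1] have to
    be increasing, one either applies [s_x] or stays ("bumps").  The word of
    [a] is split into rows, row [r < k] carrying the value [r] up to [a r].  Every
    walk bumps only at the boxes corresponding to the Bruhat covers of [m] by
    transpositions [(i, j)] with [i < k <= j], and bumping at all of them is a
    legitimate walk, which ends at the minimum of [F].  Multiplication by
    [omega] reverses the Bruhat order and turns [F] into [[sigma, eta]]. *)

Require Import Defs.
From HB Require Import structures.
From mathcomp Require Import all_boot all_order all_algebra all_fingroup.
From mathcomp Require Import boolp zify ring.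
From mathcomp.multinomials Require Import mpoly.

Set Implicit Arguments.
Unset Strict Implicit.
Unset Printing Implicit Defensive.

(** * The rank order *)

Definition swapn (x : nat) (P : nat -> nat) (y : nat) : nat :=
  if y == x then P x.+1 else if y == x.+1 then P x else P y.

Definition rank_count (P : nat -> nat) (t q : nat) : nat := \sum_(y < q) (P y < t).

(* For P = pos s and Q = pos t this is the tableau criterion for s <= t in the
   Bruhat order. *)
Definition rank_le (P Q : nat -> nat) := forall t q, rank_count Q t q <= rank_count P t q.

Definition lower (x : nat) (P : nat -> nat) := if P x < P x.+1 then P else swapn x P.
Definition raise (x : nat) (P : nat -> nat) := if P x < P x.+1 then swapn x P else P.

Ltac swapn_lia := rewrite /swapn;
  repeat match goal with |- context [?a == ?b] => case: (a =P b) => ? end;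
  try lia.

Lemma rank_countS P t q : rank_count P t q.+1 = rank_count P t q + (P q < t).
Proof. by rewrite /rank_count big_ord_recr. Qed.

Lemma eq_rank_count P Q t q : P =1 Q -> rank_count P t q = rank_count Q t q.
Proof. by move=> e; apply: eq_bigr => i _; rewrite e. Qed.

Lemma rank_count_eq_in P Q t q :
  (forall y, y < q -> P y = Q y) -> rank_count P t q = rank_count Q t q.
Proof. by move=> e; apply: eq_bigr => i _; rewrite e. Qed.

Lemma rank_count_swapn_le P x t q : q <= x -> rank_count (swapn x P) t q = rank_count P t q.
Proof. by move=> le_qx; apply: rank_count_eq_in => y lt_y; swapn_lia. Qed.

Lemma rank_count_swapn_gt P x t q : x.+1 < q -> rank_count (swapn x P) t q = rank_count P t q.
Proof.
elim: q => // q IHq; rewrite ltnS leq_eqVlt => /predU1P[<-|lt_xq].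
  by rewrite !rank_countS rank_count_swapn_le //; swapn_lia.
by rewrite !rank_countS IHq //; swapn_lia.
Qed.

(* The only count that changes becomes a monotone function of its neighbours;
   this is the lifting property of the Bruhat order. *)
Lemma rank_count_lower P x t q :
  rank_count (lower x P) t q =
    if q == x.+1 then minn (rank_count P t x).+1 (rank_count P t x.+2) else rank_count P t q.
Proof.
case: eqP => [->|ne_q]; rewrite /lower.
  case: ifP => lt_P; rewrite !rank_countS ?rank_count_swapn_le //; first lia.
  by swapn_lia.
by case: ifP => // _; have [?|?] := leqP q x;
  [rewrite rank_count_swapn_le | rewrite rank_count_swapn_gt]; lia.
Qed.

Lemma rank_count_raise P x t q :
  rank_count (raise x P) t q =
    if q == x.+1 then maxn (rank_count P t x) (rank_count P t x.+2).-1 else rank_count P t q.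
Proof.
case: eqP => [->|ne_q]; rewrite /raise.
  case: ifP => lt_P; rewrite !rank_countS ?rank_count_swapn_le //; last lia.
  by swapn_lia.
by case: ifP => // _; have [?|?] := leqP q x;
  [rewrite rank_count_swapn_le | rewrite rank_count_swapn_gt]; lia.
Qed.

Lemma rank_le_refl P : rank_le P P. Proof. by move=> t q. Qed.

Lemma rank_le_trans Q P R : rank_le P Q -> rank_le Q R -> rank_le P R.
Proof. by move=> PQ QR t q; apply: leq_trans (QR _ _) (PQ _ _). Qed.

(** Consecutive counts in [q] recover the truth value of [P y < t] for every [t], and these values
    determine [P y]. *)
Lemma rank_le_anti P Q : rank_le P Q -> rank_le Q P -> P =1 Q.
Proof.
move=> PQ QP y; have e t q : rank_count P t q = rank_count Q t q.
  by apply/eqP; rewrite eqn_leq PQ QP.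
have e1 t : (P y < t) = (Q y < t).
  by have := e t y.+1; rewrite !rank_countS e => /addnI; case: (_ < _); case: (_ < _).
by have := e1 (P y).+1; have := e1 (Q y).+1; lia.
Qed.

Lemma lower_mono x P Q : rank_le P Q -> rank_le (lower x P) (lower x Q).
Proof.
move=> PQ t q; rewrite !rank_count_lower; case: eqP => _ //.
by rewrite leq_min !geq_min ltnS PQ PQ orbT.
Qed.

Lemma raise_mono x P Q : rank_le P Q -> rank_le (raise x P) (raise x Q).
Proof.
move=> PQ t q; rewrite !rank_count_raise; case: eqP => _ //.
have := PQ t x; have := PQ t x.+2; lia.
Qed.

Lemma lower_le x P : rank_le (lower x P) P.
Proof. by move=> t q; rewrite rank_count_lower; case: eqP => [->|//]; rewrite !rank_countS; lia. Qed.

Lemma raise_ge x P : rank_le P (raise x P).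
Proof. by move=> t q; rewrite rank_count_raise; case: eqP => [->|//]; rewrite !rank_countS; lia. Qed.

(* The inverse of s as a function on nat, extended by the identity. *)
Definition pos n (s : 'S_n) (y : nat) : nat :=
  if insub y is Some i then nat_of_ord ((s^-1)%g i) else y.

Lemma pos_ord n (s : 'S_n) (i : 'I_n) : pos s i = (s^-1)%g i.
Proof. by rewrite /pos valK. Qed.

Lemma posE n (s : 'S_n) y (lt_y : y < n) : pos s y = (s^-1)%g (Ordinal lt_y).
Proof. by rewrite -pos_ord. Qed.

Lemma pos_perm n (s : 'S_n) (i : 'I_n) : pos s (s i) = i.
Proof. by rewrite pos_ord permK. Qed.

Lemma pos_ge n (s : 'S_n) y : n <= y -> pos s y = y.
Proof. by move=> le_ny; rewrite /pos insubF // ltnNge le_ny. Qed.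

Lemma pos_lt n (s : 'S_n) y : y < n -> pos s y < n.
Proof. by move=> lt_y; rewrite posE. Qed.

Lemma pos_inj n (s : 'S_n) : injective (pos s).
Proof.
move=> x y; have [ltx|lex] := ltnP x n; have [lty|ley] := ltnP y n.
- by rewrite !posE => /val_inj/perm_inj[].
- by rewrite (pos_ge _ ley) => e; have := pos_lt s ltx; lia.
- by rewrite (pos_ge _ lex) => e; have := pos_lt s lty; lia.
- by rewrite !pos_ge.
Qed.

Lemma pos_eq n (s t : 'S_n) : pos s =1 pos t -> s = t.
Proof.
move=> e; apply: invg_inj; apply/permP => i; apply: val_inj.
by rewrite /= -!pos_ord e.
Qed.

Lemma pos1 n : pos (1 : 'S_n)%g =1 id.
Proof.
move=> y; have [lt_y|le_y] := ltnP y n; last by rewrite pos_ge.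
by rewrite posE invg1 perm1.
Qed.

Lemma pos_simple n (i : 'I_n.-1) (s : 'S_n) :
  pos (simple i ** s) =1 swapn i (pos s).
Proof.
move=> y; have lt_i := hi_subproof i.
have [lt_y|le_y] := ltnP y n; last by rewrite (pos_ge _ le_y); swapn_lia; rewrite pos_ge.
rewrite posE /Defs.pcomp invMg permM /simple tpermV /swapn.
have [e|ne1] := eqVneq y i.
  have -> : Ordinal lt_y = lo i by apply: val_inj.
  by rewrite tpermL -pos_ord.
have [e|ne2] := eqVneq y i.+1.
  have -> : Ordinal lt_y = hi i by apply: val_inj.
  by rewrite tpermR -pos_ord.
by rewrite tpermD -?pos_ord // -val_eqE /= eq_sym.
Qed.

(** * Raising and lowering permutations *)

Definition asc n (i : 'I_n.-1) (s : 'S_n) : bool := pos s i < pos s i.+1.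

Definition lowerp n (i : 'I_n.-1) (s : 'S_n) := if asc i s then s else simple i ** s.

Definition raisep n (i : 'I_n.-1) (s : 'S_n) := if asc i s then simple i ** s else s.

Definition perm_le n (s t : 'S_n) := rank_le (pos s) (pos t).

Lemma eq_rank_le P P' Q Q' : P =1 P' -> Q =1 Q' -> rank_le P Q -> rank_le P' Q'.
Proof. by move=> eP eQ PQ t q; rewrite -(eq_rank_count _ _ eP) -(eq_rank_count _ _ eQ). Qed.

Lemma pos_lowerp n (i : 'I_n.-1) s : pos (lowerp i s) =1 lower i (pos s).
Proof. by move=> y; rewrite /lowerp /lower /asc; case: ifP => // _; rewrite pos_simple. Qed.

Lemma pos_raisep n (i : 'I_n.-1) s : pos (raisep i s) =1 raise i (pos s).
Proof. by move=> y; rewrite /raisep /raise /asc; case: ifP => // _; rewrite pos_simple. Qed.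

Lemma perm_le_refl n (s : 'S_n) : perm_le s s. Proof. exact: rank_le_refl. Qed.

Lemma perm_le_trans n (t s u : 'S_n) : perm_le s t -> perm_le t u -> perm_le s u.
Proof. exact: rank_le_trans. Qed.

Lemma perm_le_anti n (s t : 'S_n) : perm_le s t -> perm_le t s -> s = t.
Proof. by move=> st ts; apply: pos_eq; apply: rank_le_anti. Qed.

Lemma lowerp_mono n (i : 'I_n.-1) s t : perm_le s t -> perm_le (lowerp i s) (lowerp i t).
Proof.
move=> st; apply: eq_rank_le (lower_mono i st) => y; by rewrite pos_lowerp.
Qed.

Lemma raisep_mono n (i : 'I_n.-1) s t : perm_le s t -> perm_le (raisep i s) (raisep i t).
Proof.
move=> st; apply: eq_rank_le (raise_mono i st) => y; by rewrite pos_raisep.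
Qed.

Lemma lowerp_le n (i : 'I_n.-1) s : perm_le (lowerp i s) s.
Proof. by apply: eq_rank_le (lower_le i (pos s)) => // y; rewrite pos_lowerp. Qed.

Lemma raisep_ge n (i : 'I_n.-1) s : perm_le s (raisep i s).
Proof. by apply: eq_rank_le (raise_ge i (pos s)) => // y; rewrite pos_raisep. Qed.

Lemma simpleK n (i : 'I_n.-1) (s : 'S_n) : simple i ** (simple i ** s) = s.
Proof. by rewrite /Defs.pcomp -mulgA tperm2 mulg1. Qed.

Lemma asc_simple n (i : 'I_n.-1) s : asc i (simple i ** s) = ~~ asc i s.
Proof.
rewrite /asc !pos_simple /swapn eqxx gtn_eqF // eqxx.
by case: ltngtP => // /pos_inj; lia.
Qed.

Lemma asc_lowerp n (i : 'I_n.-1) s : asc i (lowerp i s).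
Proof. by rewrite /lowerp; case: ifP => // as_; rewrite asc_simple as_. Qed.

Lemma raisep_lowerp n (i : 'I_n.-1) s : raisep i (lowerp i s) = raisep i s.
Proof.
rewrite /raisep asc_lowerp /lowerp; case: ifP => // _; exact: simpleK.
Qed.

Lemma rank_count_inj P t q : injective P -> rank_count P t q <= t.
Proof.
move=> injP.
have -> : rank_count P t q = count (fun x => x < t) (map P (iota 0 q)).
  elim: q => [|q IHq]; first by rewrite /rank_count big_ord0.
  by rewrite rank_countS IHq -[q.+1]addn1 iotaD map_cat count_cat /= add0n addn0.
rewrite -size_filter -[leqRHS](size_iota 0) uniq_leq_size //.
  by rewrite filter_uniq // map_inj_uniq ?iota_uniq.
by move=> x; rewrite mem_filter mem_iota => /andP[].
Qed.

(** The identity has the counts [minn t q], the largest possible for an injective function. *)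
Lemma perm_le1 n (s : 'S_n) : perm_le 1%g s.
Proof.
move=> t q; rewrite (eq_rank_count _ _ (@pos1 n)).
have -> : rank_count id t q = minn t q.
  elim: q => [|q IHq]; first by rewrite /rank_count big_ord0 minn0.
  by rewrite rank_countS IHq; lia.
have lt_q : rank_count (pos s) t q <= q.
  elim: q => [|q IHq]; first by rewrite /rank_count big_ord0.
  by rewrite rank_countS; case: (_ < t); lia.
by rewrite leq_min lt_q andbT rank_count_inj //; apply: pos_inj.
Qed.

(** An increasing self-map of an initial segment satisfies [y <= pos s y] by induction from the left
    end and the reverse inequality by induction from the right end. *)
Lemma asc_all n (s : 'S_n) : (forall i : 'I_n.-1, asc i s) -> s = 1%g.
Proof.
move=> asc_s; have le_pos y : y < n -> y <= pos s y.
  elim: y => // y IHy lt_y; have lt_i : y < n.-1 by lia.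
  by have := asc_s (Ordinal lt_i); have := IHy (ltnW lt_y); rewrite /asc /=; lia.
have ge_pos d : d < n -> pos s (n.-1 - d) <= n.-1 - d.
  elim: d => [|d IHd] lt_d.
    by rewrite subn0 -ltnS prednK ?pos_lt //; lia.
  have lt_i : n.-1 - d.+1 < n.-1 by lia.
  have := asc_s (Ordinal lt_i); rewrite /asc /=.
  rewrite -subSn; last by lia.
  by rewrite subSS; have := IHd (ltnW lt_d); lia.
apply: pos_eq => y; rewrite pos1; have [lt_y|/pos_ge//] := ltnP y n.
apply/eqP; rewrite eqn_leq le_pos // andbT.
by have := ge_pos (n.-1 - y); rewrite subKn; [apply; lia | lia].
Qed.

Lemma exists_descent n (s : 'S_n) : s != 1%g -> exists i : 'I_n.-1, ~~ asc i s.
Proof.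
move=> ne; apply/existsP; rewrite -negb_forall; apply: contra ne.
by move/forallP/asc_all=> ->.
Qed.

(** * Length, reduced words and the Bruhat order *)

Lemma ell1 n : ell (1 : 'S_n)%g = 0.
Proof.
apply/eqP; rewrite cards_eq0; apply/eqP/setP=> p; rewrite !inE !perm1.
by case: ltngtP.
Qed.

(** Exchanging two adjacent values changes the relative order of a single pair of positions, the
    pair [(al, be)] where they stand. *)
Lemma ell_simple n (i : 'I_n.-1) (s : 'S_n) :
  asc i s -> ell (simple i ** s) = (ell s).+1.
Proof.
move=> as_; pose al := (s^-1)%g (lo i); pose be := (s^-1)%g (hi i).
have lt_ab : al < be by rewrite -!pos_ord.
have sal : s al = lo i by rewrite permKV.
have sbe : s be = hi i by rewrite permKV.
have lohi : (lo i : nat).+1 = hi i by [].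
rewrite /ell (cardsD1 (al, be)) !inE /= lt_ab /Defs.pcomp !permM sal sbe.
rewrite /simple tpermL tpermR ltnSn add1n; congr S; apply: eq_card => -[x y].
rewrite !inE /= !permM xpair_eqE.
have ex : (x == al) = (s x == lo i) by rewrite -sal (inj_eq perm_inj).
have ey : (y == be) = (s y == hi i) by rewrite -sbe (inj_eq perm_inj).
have ex' : (x == be) = (s x == hi i) by rewrite -sbe (inj_eq perm_inj).
have ey' : (y == al) = (s y == lo i) by rewrite -sal (inj_eq perm_inj).
have ne : (x == y) = (s x == s y) by rewrite (inj_eq perm_inj).
have vx := ltn_ord (s x).
rewrite ex ey; move: ex ey ex' ey' ne; rewrite -!val_eqE.
case: tpermP => [->|->|/eqP n1 /eqP n2]; case: tpermP => [->|->|/eqP n3 /eqP n4] //=;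
  rewrite ?eqxx; move: lt_ab lohi; rewrite -?val_eqE; try (move: n1 n2);
  try (move: n3 n4); rewrite -?val_eqE /=; lia.
Qed.

Lemma ell_desc n (i : 'I_n.-1) (s : 'S_n) :
  ~~ asc i s -> ell s = (ell (simple i ** s)).+1.
Proof.
by move=> ds; rewrite -[in LHS](simpleK i s) ell_simple // asc_simple ds.
Qed.

Lemma ell_wprod n (w : seq 'I_n.-1) : ell (wprod w) <= size w.
Proof.
elim: w => [|i w IHw] /=; first by rewrite ell1.
case: (boolP (asc i (wprod w))) => [/ell_simple ->|/ell_desc] //.
by move=> e; apply: leq_trans (leqnSn _); apply: leq_trans IHw; rewrite e.
Qed.

Lemma exists_word n (s : 'S_n) : exists2 w, wprod w = s & size w = ell s.
Proof.
elim: {s}(ell s) {-2}s (erefl (ell s)) => [|l IHl] s e.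
  exists [::] => //; apply/esym/eqP; apply: contraT => /exists_descent[i /ell_desc].
  by rewrite e.
have ne1 : s != 1%g by apply: contra_eqN e => /eqP->; rewrite ell1.
have [i di] := exists_descent ne1.
have [|w ew ew_size] := IHl (simple i ** s); first by have := ell_desc di; lia.
by exists (i :: w); rewrite /= ?ew ?simpleK // ew_size [RHS](ell_desc di).
Qed.

Lemma reducedP n (s : 'S_n) w : reduced s w <-> wprod w = s /\ size w = ell s.
Proof.
split=> [[e min_w]|[e sz]]; split=> //.
  have [w' e' sz'] := exists_word s; apply/eqP; rewrite eqn_leq -{2}e ell_wprod andbT.
  by rewrite -sz'; apply: min_w.
by move=> w' e'; rewrite sz -e' ell_wprod.
Qed.

Lemma reduced_cons n (s : 'S_n) i w :
  reduced s (i :: w) <-> ~~ asc i s /\ reduced (simple i ** s) w.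
Proof.
rewrite !reducedP /=; split=> [[e sz]|[di [e sz]]].
  have di : ~~ asc i s.
    apply/negP=> ai; have := ell_wprod w.
    have -> : wprod w = simple i ** s by rewrite -e simpleK.
    by rewrite ell_simple //; lia.
  split=> //; split; first by rewrite -e simpleK.
  by have := ell_desc di; lia.
by rewrite e simpleK sz -ell_desc.
Qed.

Lemma reduced_asc n (s : 'S_n) i w :
  asc i s -> reduced s w -> reduced (simple i ** s) (i :: w).
Proof. by move=> ai rw; apply/reduced_cons; rewrite asc_simple ai simpleK. Qed.

(** Here [w] need not be reduced. If [w] uses the first letter [j] of [w'], monotonicity of
    [raisep j] applies; if it skips it, [m] lies above [simple j ** m] anyway. *)
Lemma subword_perm_le n (w w' : seq 'I_n.-1) (m : 'S_n) :
  reduced m w' -> subseq w w' -> perm_le (wprod w) m.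
Proof.
elim: w' w m => [|j w' IH] w m.
  by move=> _; rewrite subseq0 => /eqP->; apply: perm_le1.
move=> /reduced_cons[dj red].
have m_mx : m = raisep j (simple j ** m) by rewrite /raisep asc_simple dj simpleK.
case: w => [|i w] /=; first by move=> _; apply: perm_le1.
case: eqP => [-> /(IH _ _ red) le|_ /(IH _ _ red) /= le].
  rewrite m_mx; apply: perm_le_trans (raisep_mono j le).
  rewrite /raisep; case: ifP => [_|/negbT dw]; first exact: perm_le_refl.
  by have := lowerp_le j (wprod w); rewrite /lowerp (negbTE dw).
by apply: perm_le_trans le _; rewrite [X in perm_le _ X]m_mx; apply: raisep_ge.
Qed.

(** For the converse, [lowerp i] at a descent [i] of [m] preserves the comparison. The subword found
    by induction then receives the letter [i] exactly when [i] is a descent of [s]. *)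
Lemma bruhatP n (s m : 'S_n) : bruhat s m <-> perm_le s m.
Proof.
split=> [[w [w' [[<- _] red sub]]]|]; first exact: subword_perm_le red sub.
elim: {m}(ell m) {-2}m (erefl (ell m)) s => [|l IHl] m e s le_sm.
  have m1 : m = 1%g.
    by apply/eqP; apply: contraT => /exists_descent[i /ell_desc]; rewrite e.
  have s1 : s = 1%g by apply: perm_le_anti (perm_le1 s); rewrite -m1.
  by exists [::], [::]; split=> //; rewrite ?s1 ?m1; split.
have ne1 : m != 1%g by apply: contra_eqN e => /eqP->; rewrite ell1.
have [i di] := exists_descent ne1.
have mn_m : lowerp i m = simple i ** m by rewrite /lowerp (negbTE di).
have em : ell (simple i ** m) = l by have := ell_desc di; lia.
have le_i : perm_le (lowerp i s) (simple i ** m) by rewrite -mn_m; apply: lowerp_mono.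
have [w [w' [rw rw' sub]]] := IHl _ em _ le_i.
have rm : reduced m (i :: w') by apply/reduced_cons.
move: rw; rewrite /lowerp; case: ifP => [ai rw|/negbT ds rw].
  by exists w, (i :: w'); split=> //; apply: subseq_trans sub (subseq_cons _ _).
by exists (i :: w), (i :: w'); split; rewrite //= ?eqxx //; apply/reduced_cons.
Qed.

Lemma bruhat_ell n (s m : 'S_n) : bruhat s m -> ell s <= ell m.
Proof.
by move=> [w [w' [/reducedP[_ <-] /reducedP[_ <-] /size_subseq]]].
Qed.

(** * Reduced words *)

Notation act_word T w f := (foldl (fun g i => T i g) f w).

Definition braided n X (T : 'I_n.-1 -> X -> X) :=
  (forall i j : 'I_n.-1, i.+1 < j -> forall f, T i (T j f) = T j (T i f)) /\
  (forall i j : 'I_n.-1, j = i.+1 :> nat ->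
     forall f, T i (T j (T i f)) = T j (T i (T j f))).

Lemma eq_swapn x P Q : P =1 Q -> swapn x P =1 swapn x Q.
Proof. by move=> e y; rewrite /swapn !e. Qed.

Lemma pos_simple2 n (i j : 'I_n.-1) (s : 'S_n) :
  pos (simple i ** (simple j ** s)) =1 swapn i (swapn j (pos s)).
Proof. by move=> y; rewrite pos_simple; apply/eq_swapn/pos_simple. Qed.

Lemma pos_simple3 n (i j k : 'I_n.-1) (s : 'S_n) :
  pos (simple i ** (simple j ** (simple k ** s))) =1 swapn i (swapn j (swapn k (pos s))).
Proof. by move=> y; rewrite pos_simple; apply/eq_swapn/pos_simple2. Qed.

Lemma reduced_cons_desc n (s : 'S_n) i w :
  ~~ asc i s -> reduced (simple i ** s) w -> reduced s (i :: w).
Proof. by move=> di rw; apply/reduced_cons. Qed.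

(** When [i] and [j] are both descents, the longest element of the group generated by [simple i] and
    [simple j] splits off on the left of [s]. Its two reduced words are completed by the same word
    [z]. *)
Lemma dihedral_words n X (T : 'I_n.-1 -> X -> X) (s : 'S_n) (i j : 'I_n.-1) :
  braided T -> i < j -> ~~ asc i s -> ~~ asc j s ->
  exists u u', [/\ reduced s (i :: u), reduced s (j :: u') &
    forall f, act_word T (i :: u) f = act_word T (j :: u') f].
Proof.
move=> [comm braid] lt_ij di dj; have [e|ne] := eqVneq (i.+1) j.
  have [z rz] := exists_reduced (simple i ** (simple j ** (simple i ** s))).
  have E : simple i ** (simple j ** (simple i ** s)) =
           simple j ** (simple i ** (simple j ** s)).
    by apply: pos_eq => y; rewrite !pos_simple3 -e; swapn_lia.
  move: di dj; rewrite /asc -e => di dj.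
  exists (j :: i :: z), (i :: j :: z); split=> [||f] /=; last by rewrite braid.
  - refine (reduced_cons_desc _ (reduced_cons_desc _ (reduced_cons_desc _ _)));
      rewrite // /asc -?e.
    + by rewrite !pos_simple; swapn_lia.
    + by rewrite !pos_simple2 -e; swapn_lia.
  - refine (reduced_cons_desc _ (reduced_cons_desc _ (reduced_cons_desc _ _)));
      rewrite -?E // /asc -?e //.
    + by rewrite !pos_simple -e; swapn_lia.
    + by rewrite !pos_simple2 -e; swapn_lia.
have [z rz] := exists_reduced (simple j ** (simple i ** s)).
have E : simple j ** (simple i ** s) = simple i ** (simple j ** s).
  by apply: pos_eq => y; rewrite !pos_simple2; swapn_lia.
move: (di) (dj); rewrite /asc => di' dj'.
exists (j :: z), (i :: z); split=> [||f] /=; last by rewrite -(comm i j) //; lia.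
- refine (reduced_cons_desc _ (reduced_cons_desc _ _)) => //.
  by rewrite /asc !pos_simple; swapn_lia.
- refine (reduced_cons_desc _ (reduced_cons_desc _ _)); rewrite -?E //.
  by rewrite /asc !pos_simple; swapn_lia.
Qed.

(** Induction on the length settles words with a common first letter; words with different first
    letters are linked through the two words of [dihedral_words]. Leaving [T] arbitrary serves both
    [isob] and [isobhat]. *)
Lemma matsumoto n X (T : 'I_n.-1 -> X -> X) (s : 'S_n) w w' f :
  braided T -> reduced s w -> reduced s w' -> act_word T w f = act_word T w' f.
Proof.
move=> br; elim: {s}(ell s) {-2}s (erefl (ell s)) w w' f => [|l IHl] s es w w' f.
  move=> /reducedP[_]; rewrite es => /size0nil->.
  by move=> /reducedP[_]; rewrite es => /size0nil->.
have step i u u' g : reduced s (i :: u) -> reduced s (i :: u') ->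
    act_word T (i :: u) g = act_word T (i :: u') g.
  move=> /reduced_cons[di ru] /reduced_cons[_ ru'].
  by apply: (IHl _ _ _ _ _ ru ru'); have := ell_desc di; lia.
case: w => [/reducedP[_]|i w red]; first by rewrite es.
case: w' => [/reducedP[_]|j w' red']; first by rewrite es.
have [di _] := (reduced_cons _ _ _).1 red.
have [dj _] := (reduced_cons _ _ _).1 red'.
case: (ltngtP i j) => [lt_ij|lt_ji|/val_inj e].
- have [u [u' [ru ru' e]]] := dihedral_words br lt_ij di dj.
  by rewrite (step _ _ _ _ red ru) e; apply: step.
- have [u [u' [ru ru' e]]] := dihedral_words br lt_ji dj di.
  by rewrite (step _ _ _ _ red ru') -e; apply: step.
by move: red'; rewrite -e; apply: step.
Qed.

(** * Rows of labels *)

Section Rows.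
Implicit Types (B : nat -> bool) (P : nat -> nat).

Definition rstep x (b : bool) P := if b then P else swapn x P.

(* P lists labels by value. The label at x is carried rightwards through the
   positions x + 1, ..., x + l; when B y holds it is left at y - 1 and the label
   at y is carried on instead. *)
Fixpoint row_walk x l B P : nat -> nat :=
  if l is l'.+1 then row_walk x.+1 l' B (rstep x (B x.+1) P) else P.

Fixpoint row_ok x l B P : bool :=
  if l is l'.+1 then (P x < P x.+1) && row_ok x.+1 l' B (rstep x (B x.+1) P) else true.

Lemma rstep_out x b P y : y != x -> y != x.+1 -> rstep x b P y = P y.
Proof. by rewrite /rstep; case: b => //; swapn_lia. Qed.

Lemma rstep_l x b P : rstep x b P x = if b then P x else P x.+1.
Proof. by rewrite /rstep; case: b => //; swapn_lia. Qed.

Lemma rstep_r x b P : rstep x b P x.+1 = if b then P x.+1 else P x.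
Proof. by rewrite /rstep; case: b => //; swapn_lia. Qed.

Lemma row_out x l B P y : (y < x) || (x + l < y) -> row_walk x l B P y = P y.
Proof.
elim: l x P => //= l IHl x P y_out; rewrite IHl ?rstep_out //; lia.
Qed.

(** In a legitimate walk the carried label is [P x] or the label picked up at the latest bump, and
    it grows at each bump. The recursive check thus becomes a set of inequalities between initial
    labels. *)
Lemma row_okP x l B P :
  reflect ((forall y, x < y <= x + l -> P x < P y) /\
           (forall y z, x < y < z -> z <= x + l -> B y -> P y < P z))
          (row_ok x l B P).
Proof.
apply: (iffP idP); elim: l x P => /= [|l IHl] x P.
- by split=> [y|y z]; lia.
- case/andP=> lt_x /IHl[]; rewrite rstep_r => H1 H2; split=> [y|y z].
    have [->//|ne] := eqVneq y x.+1 => y_in.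
    have := H1 y; rewrite rstep_out; try lia.
    by case: (B _) => /(_ _); lia.
  move=> lt_yz le_z By; have [e|ne] := eqVneq y x.+1.
    by have := H1 z; rewrite -e By rstep_out; [apply; lia | lia | lia].
  by have := H2 y z; rewrite !rstep_out //; try lia; apply => //; lia.
- by [].
case=> H1 H2; apply/andP; split; first by apply: H1; lia.
apply: IHl; split=> [y y_in|y z lt_yz le_z By].
  rewrite rstep_r rstep_out; try lia.
  by case: ifP => Bx; [apply: H2 => //; lia | apply: H1; lia].
by rewrite !rstep_out; try lia; apply: H2 => //; lia.
Qed.

Lemma row_cross x l B P y : x < y <= x + l -> ~~ B y -> row_walk x l B P y.-1 = P y.
Proof.
elim: l x P => /= [|l IHl] x P y_in nBy; first by lia.
have [e|ne] := eqVneq y x.+1.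
  by rewrite e /= row_out ?rstep_l -?e ?(negbTE nBy) // e; lia.
by rewrite IHl ?rstep_out //; lia.
Qed.

Lemma row_bump x l B P y :
  row_ok x l B P -> x < y <= x + l -> B y -> P x <= row_walk x l B P y.-1 < P y.
Proof.
elim: l x P => /= [|l IHl] x P; first by lia.
case/andP=> lt_x ok y_in By; have [e|ne] := eqVneq y x.+1.
  by rewrite e /= row_out ?rstep_l -?e ?By ?e ?leqnn //; lia.
have := IHl _ _ ok; rewrite rstep_r => /(_ _ By).
rewrite rstep_out //; try lia.
by case: (B _) => /(_ _); lia.
Qed.

Lemma row_bump2 x l B P y z :
  row_ok x l B P -> x < y < z -> z <= x + l -> B y -> B z -> P y <= row_walk x l B P z.-1.
Proof.
elim: l x P => /= [|l IHl] x P; first by lia.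
case/andP=> lt_x ok lt_yz le_z By Bz; have [e|ne] := eqVneq y x.+1.
  have := row_bump ok _ Bz; rewrite rstep_r -e By => /(_ _) H.
  by have := H ltac:(lia); lia.
by have := IHl _ _ ok _ _ By Bz; rewrite rstep_out; lia.
Qed.

Lemma row_first x l B P y : x < y <= x + l -> B y ->
  exists z, [/\ x < z <= y, B z & row_walk x l B P z.-1 = P x].
Proof.
elim: l x P => /= [|l IHl] x P y_in By; first by lia.
case: (boolP (B x.+1)) => Bx.
  exists x.+1; split=> //; first by lia.
  by rewrite /= row_out ?rstep_l //; lia.
have ne : y != x.+1 by apply: contraNneq Bx => <-.
have [||z [z_in Bz e]] := IHl x.+1 (rstep x (B x.+1) P) => //; first by lia.
exists z; split=> //; first by lia.
by move: e; rewrite (negbTE Bx) => ->; rewrite rstep_r.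
Qed.

Variable len : nat -> nat.

(* Rows 0, ..., c - 1 are still to be walked, row r starting at r with the label
   P r and having length len r; its columns are currently at c, ..., c + len r - 1. *)
Definition valid c P := forall r y, r < c -> c <= y < c + len r -> P r < P y.

(* Exchanging the labels P r and P y is a Bruhat cover of the permutation obtained
   by walking all remaining rows without bumps. *)
Definition bumpable c P r y : Prop :=
  [/\ c <= y < c + len r,
      forall r', r' < r -> P r < P r' -> c + len r' <= y &
      forall z, y < z < c + len r -> P y < P z].

Definition bumps c P r y : bool := `[< bumpable c P r y >].

Section MinSide.
Variables (x : nat) (P : nat -> nat).
Hypothesis len_mono' : forall r r', r <= r' -> r' <= x -> len r <= len r'.
Hypothesis valP : valid x.+1 P.
Hypothesis injP : injective P.
Let B := bumps x.+1 P x.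
Let P' := row_walk x (len x) B P.

Let len_mono r (lt_r : r < x) : len r <= len x := len_mono' (ltnW lt_r) (leqnn x).

Lemma min_row_ok : row_ok x (len x) B P.
Proof.
apply/row_okP; split=> [y y_in|y z lt_yz le_z /asboolP[_ _ H]].
  by apply: valP; lia.
by apply: H; lia.
Qed.

(** Otherwise [P r] would be the larger label, and the second clause of [bumpable] would forbid row
    [x] to bump in the columns of row [r]. *)
Lemma min_low r y : r < x -> x < y <= x + len r -> B y -> P r < P x.
Proof.
move=> lt_rx y_in /asboolP[_ H _]; rewrite ltnNge leq_eqVlt negb_or -leqNgt.
apply/andP; split; first by apply/eqP=> /injP; lia.
by rewrite leqNgt; apply/negP=> /(H _ lt_rx); lia.
Qed.

(** At a bump the label left behind is at least [P x], which exceeds [P r] by [min_low]; elsewhere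
    it is an old label moved one column to the left. *)
Lemma min_valid : valid x P'.
Proof.
move=> r y lt_rx y_in; have le_r := len_mono lt_rx.
rewrite /P' row_out ?lt_rx //; case: (boolP (B y.+1)) => By.
  have := row_bump min_row_ok (y := y.+1) _ By; move/(_ ltac:(lia)) => /=.
  have := min_low (y := y.+1) lt_rx _ By; move/(_ ltac:(lia)); rewrite -/P'; lia.
rewrite -[y]/(y.+1.-1) row_cross //; last by lia.
by apply: valP; lia.
Qed.

(** Only the last clause of [bumpable] needs an argument, as the labels of the rows [r < x] do not
    move. The delicate case is a bump at [z.+1] without one at [y.+1]: the conditions on the boxes
    [(r, y.+1)] and [(x, z.+1)] together make [(x, y.+1)] bumpable, a contradiction. *)
Lemma min_bumpable r y :
  r < x -> bumpable x.+1 P r y.+1 -> bumpable x P' r y.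
Proof.
move=> lt_rx [y_in low rtl]; have le_r := len_mono lt_rx.
have P'r r' : r' < x -> P' r' = P r' by move=> lt'; rewrite /P' row_out ?lt'.
split=> [|r' lt_r'|z z_in]; first by lia.
  by rewrite !P'r //; [move/(low _ lt_r'); lia | lia].
have cross t : x <= t < x + len x -> ~~ B t.+1 -> P' t = P t.+1.
  by move=> t_in nB; rewrite /P' -[t]/(t.+1.-1) row_cross //; lia.
have lt_P := rtl z.+1 ltac:(lia).
case: (boolP (B y.+1)) => By.
  have := row_bump min_row_ok (y := y.+1) _ By; move/(_ ltac:(lia)); rewrite -/P' /= => Hy.
  case: (boolP (B z.+1)) => Bz; last by rewrite (cross z) //; lia.
  have := row_bump2 min_row_ok (y := y.+1) (z := z.+1) _ _ By Bz.
  by move=> /(_ ltac:(lia) ltac:(lia)); rewrite -/P' /=; lia.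
rewrite (cross y) //; last by lia.
suff nBz : ~~ B z.+1 by rewrite cross //; lia.
apply/negP=> Bz; have lt_h := min_low (y := z.+1) lt_rx ltac:(lia) Bz.
have [_ lowz rtlz] := asboolP _ Bz.
case/negP: By; apply/asboolP; split=> [|r' lt_r' lt_h'|t t_in]; first by lia.
  have [lt_rr'|] := ltnP r' r; first by apply: low => //; apply: ltn_trans lt_h'.
  (* Rows get longer, so column [z.+1], which lies in row [r], also lies in row [r']; this
     contradicts [lowz]. *)
  move=> le_rr'; have := lowz _ lt_r' lt_h'.
  by have := @len_mono' r r' le_rr' (ltnW lt_r'); lia.
have [lt_t|le_t] := ltnP t (x.+1 + len r); first by apply: rtl; lia.
apply: ltn_trans lt_P _; apply: rtlz; lia.
Qed.

End MinSide.

Section AnySide.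
Variables (x : nat) (P : nat -> nat) (B : nat -> bool).
Hypothesis len_mono : forall r, r < x -> len r <= len x.
Hypothesis okB : row_ok x (len x) B P.
Let P' := row_walk x (len x) B P.
Hypothesis valP' : valid x P'.

Lemma any_le y : x < y <= x + len x -> P' y.-1 <= P y.
Proof.
move=> y_in; case: (boolP (B y)) => By; last by rewrite /P' row_cross.
by have := row_bump okB y_in By; rewrite -/P'; lia.
Qed.

(** By [any_le] a row walk can only decrease the label found in a column, after the shift by one, so
    validity for the rows [r < x] passes back from [P'] to [P]. *)
Lemma any_valid : valid x.+1 P.
Proof.
move=> r y lt_r y_in; have [e|ne] := eqVneq r x.
  by move/row_okP: okB => [H _]; rewrite e in y_in *; apply: H; lia.
have lt_rx : r < x by lia.
have le_r := len_mono lt_rx.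
have := valP' (r := r) (y := y.-1) lt_rx ltac:(lia).
have := any_le (y := y) ltac:(lia).
by rewrite {2}/P' row_out ?lt_rx //; lia.
Qed.

(* A bump in a column shared with a row still to be walked and of larger label
   would leave there a label too small for that row. *)
Lemma any_bumps y : x < y <= x + len x -> B y -> bumpable x.+1 P x y.
Proof.
move=> y_in By; split=> [|r lt_rx lt_h|z z_in]; first by lia.
  rewrite leqNgt; apply/negP=> lt_y.
  have [z [z_in Bz e]] := row_first P y_in By.
  have := valP' (r := r) (y := z.-1) lt_rx ltac:(lia).
  by rewrite /P' e row_out ?lt_rx //; lia.
by move/row_okP: okB => [_]; apply => //; lia.
Qed.

(** This is the counterpart of [min_bumpable], going backwards along an arbitrary legitimate walk.
    At a bump the last clause comes from [row_okP]; elsewhere [P y.+1] equals [P' y] and [any_le]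
    bounds the other side. *)
Lemma any_bumpable r y : r < x -> bumpable x P' r y -> bumpable x.+1 P r y.+1.
Proof.
move=> lt_rx [y_in low rtl]; have le_r := len_mono lt_rx.
have P'r r' : r' < x -> P' r' = P r' by move=> lt'; rewrite /P' row_out ?lt'.
split=> [|r' lt_r'|z z_in]; first by lia.
  by have := low _ lt_r'; rewrite !P'r ?(ltn_trans lt_r') //; lia.
case: (boolP (B y.+1)) => By.
  by move/row_okP: okB => [_ H]; apply: H By; lia.
have := rtl z.-1 ltac:(lia); have := any_le (y := z) ltac:(lia).
by rewrite {2}/P' -[y]/(y.+1.-1) row_cross //=; lia.
Qed.

End AnySide.
End Rows.

(** * Fibers of the lowering maps *)

Fixpoint lowers n (ws : seq 'I_n.-1) (u : 'S_n) : 'S_n :=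
  if ws is i :: ws' then lowerp i (lowers ws' u) else u.

Lemma lowerp_eq n (i : 'I_n.-1) (y v : 'S_n) :
  (lowerp i y == v) = asc i v && ((y == v) || (y == simple i ** v)).
Proof.
apply/eqP/andP=> [<-|[av]].
  rewrite asc_lowerp /lowerp; split=> //; case: ifP; rewrite ?simpleK eqxx ?orbT //.
by case/orP=> /eqP->; rewrite /lowerp ?asc_simple av //= simpleK.
Qed.

Lemma lowers_cat n (w1 w2 : seq 'I_n.-1) (u : 'S_n) :
  lowers (w1 ++ w2) u = lowers w1 (lowers w2 u).
Proof. by elim: w1 => //= i w1 ->. Qed.

Lemma lowers_mono n (ws : seq 'I_n.-1) (u u' : 'S_n) :
  perm_le u u' -> perm_le (lowers ws u) (lowers ws u').
Proof. by move=> le_u; elim: ws => //= i ws; apply: lowerp_mono. Qed.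

Fixpoint push n (ws : seq 'I_n.-1) (v : 'S_n) : 'S_n :=
  if ws is i :: ws' then push ws' (simple i ** v) else v.

Lemma push_cat n (w1 w2 : seq 'I_n.-1) (v : 'S_n) :
  push (w1 ++ w2) v = push w2 (push w1 v).
Proof. by elim: w1 v => //= i w1 IH v; rewrite IH. Qed.

Lemma push_wprod n (ws : seq 'I_n.-1) (v : 'S_n) :
  push ws v = wprod (rev ws) ** v.
Proof.
elim: ws v => [|i ws IHws] v; first by rewrite /Defs.pcomp mulg1.
rewrite rev_cons -cats1 wprod_cat /= IHws /Defs.pcomp mul1g -!mulgA //.
Qed.

Lemma ell_push n (ws : seq 'I_n.-1) (v : 'S_n) :
  ell (push ws v) <= size ws + ell v.
Proof.
elim: ws v => //= i ws IHws v; apply: leq_trans (IHws _) _.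
by case: (boolP (asc i v)) => [/ell_simple->|/ell_desc->]; lia.
Qed.

(** Additivity of lengths makes every letter act at an ascent. The upper bound follows letter by
    letter, since an element lies below its [raisep i], which depends only on its [lowerp i]. *)
Lemma push_fiber n (ws : seq 'I_n.-1) (v : 'S_n) :
  ell (push ws v) = size ws + ell v ->
  lowers ws (push ws v) = v /\ forall u, perm_le (lowers ws u) v -> perm_le u (push ws v).
Proof.
elim: ws v => //= i ws IHws v e.
have av : asc i v.
  apply/negPn/negP=> /ell_desc e'.
  by have := ell_push ws (simple i ** v); rewrite e; lia.
have [-> le_u] := IHws (simple i ** v) ltac:(rewrite e ell_simple //; lia).
split=> [|u le_v]; first by rewrite /lowerp asc_simple av simpleK.
apply: le_u; apply: perm_le_trans (raisep_ge i _) _.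
by rewrite -raisep_lowerp; have := raisep_mono i le_v; rewrite {2}/raisep av.
Qed.

(** * Row walks on permutations *)

Section Walks.
Variable N : nat.
Local Notation n := N.+2.
Implicit Types (u v w : 'S_n) (B : nat -> bool).

(** The shape [N.+2] keeps ['I_n.-1] inhabited, as [inord] requires. The index is faithful only for
    [x.+1 < n], hence the bounds in the lemmas on walks. *)
Definition letter (x : nat) : 'I_n.-1 := inord x.
Definition letters x l : seq 'I_n.-1 := [seq letter y | y <- iota x l].

Fixpoint row_walkp x l B v : 'S_n :=
  if l is l'.+1 then
    row_walkp x.+1 l' B (if B x.+1 then v else simple (letter x) ** v)
  else v.

Lemma pos_letter x v : x.+1 < n -> pos (simple (letter x) ** v) = swapn x (pos v).
Proof. by move=> lt_x; apply/funext=> y; rewrite pos_simple inordK //; lia. Qed.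

Lemma asc_letter x v : x.+1 < n -> asc (letter x) v = (pos v x < pos v x.+1).
Proof. by move=> lt_x; rewrite /asc inordK //; lia. Qed.

Lemma pos_rstep x (b : bool) v : x.+1 < n ->
  pos (if b then v else simple (letter x) ** v) = rstep x b (pos v).
Proof. by move=> lt_x; rewrite /rstep; case: b => //; rewrite pos_letter. Qed.

Lemma pos_row_walkp x l B v : x + l < n -> pos (row_walkp x l B v) = row_walk x l B (pos v).
Proof.
elim: l x v => //= l IHl x v lt_x; rewrite IHl; last by lia.
by rewrite pos_rstep //; lia.
Qed.

Lemma row_walkp_ext x l B B' v :
  (forall y, x < y -> B y = B' y) -> row_walkp x l B v = row_walkp x l B' v.
Proof.
elim: l x v => //= l IHl x v e; rewrite e // (IHl x.+1) // => y lt_y.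
by apply: e; lia.
Qed.

Lemma row_ok_ext x l B B' P :
  (forall y, x < y -> B y = B' y) -> row_ok x l B P = row_ok x l B' P.
Proof.
elim: l x P => //= l IHl x P e; rewrite e // (IHl x.+1) // => y lt_y.
by apply: e; lia.
Qed.

Lemma lowers_row_walkp x l B v : x + l < n -> row_ok x l B (pos v) ->
  lowers (letters x l) (row_walkp x l B v) = v.
Proof.
elim: l x v => //= l IHl x v lt_x /andP[av ok].
rewrite IHl ?pos_rstep //; try lia.
move: av; rewrite -asc_letter /lowerp; last by lia.
by case: (B _) => av; rewrite ?av // asc_simple av simpleK.
Qed.

(** This reads an arbitrary element of a fiber as a walk: a bump is recorded exactly where [lowerp]
    changes nothing. *)
Lemma lowers_rowP x l u : x + l < n ->
  exists2 B, row_ok x l B (pos (lowers (letters x l) u)) &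
    u = row_walkp x l B (lowers (letters x l) u).
Proof.
elim: l x => [|l IHl] x lt_x /=; first by exists xpred0.
have [B ok e] := IHl x.+1 ltac:(lia); set y := lowers _ u in ok e *.
pose B' t := if t == x.+1 then asc (letter x) y else B t.
have eB t : x.+1 < t -> B' t = B t by rewrite /B' => lt_t; rewrite gtn_eqF.
have B'x : B' x.+1 = asc (letter x) y by rewrite /B' eqxx.
have ey : (if B' x.+1 then lowerp (letter x) y
           else simple (letter x) ** lowerp (letter x) y) = y.
  by rewrite B'x /lowerp; case: (asc _ y); rewrite ?simpleK.
exists B'; last by rewrite ey (row_walkp_ext _ _ eB).
rewrite -pos_rstep ?ey ?(row_ok_ext _ _ eB) ?ok ?andbT; try lia.
by rewrite -asc_letter ?asc_lowerp //; lia.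
Qed.

Lemma row_walkp_cross x l v : row_walkp x l xpred0 v = push (letters x l) v.
Proof. by elim: l x v => //= l IHl x v; rewrite IHl. Qed.

Lemma ell_row_walkp_cross x l v : x + l < n -> row_ok x l xpred0 (pos v) ->
  ell (row_walkp x l xpred0 v) = l + ell v.
Proof.
elim: l x v => //= l IHl x v lt_x /andP[av ok].
rewrite IHl ?pos_letter //; try lia.
by rewrite ell_simple ?asc_letter; lia.
Qed.

(* Each swap goes up in the Bruhat order, so bumping more often gives less. *)
Lemma row_walkp_mono x l B B' v v' : x + l < n ->
  row_ok x l B (pos v) -> row_ok x l B' (pos v') ->
  (forall y, x < y <= x + l -> B' y -> B y) ->
  perm_le v v' -> perm_le (row_walkp x l B v) (row_walkp x l B' v').
Proof.
elim: l x v v' => //= l IHl x v v' lt_x /andP[av ok] /andP[av' ok'] sub le_v.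
apply: IHl; rewrite ?pos_rstep //; try lia.
  by move=> y y_in; apply: sub; lia.
rewrite -asc_letter in av; last by lia.
rewrite -asc_letter in av'; last by lia.
have := sub x.+1 ltac:(lia).
have := raisep_mono (letter x) le_v; rewrite /raisep av av' => le_mx.
case: (B' _) => [->//|_]; case: (B _) => //.
apply: perm_le_trans le_v _.
by have := raisep_ge (letter x) v'; rewrite /raisep av'.
Qed.

Variables (k : nat) (len : nat -> nat).
Hypothesis len_mono : forall r r', r <= r' -> r' < k -> len r <= len r'.
Hypothesis len_lt : forall r, r < k -> r + len r < n.

Fixpoint rword c : seq 'I_n.-1 :=
  if c is x.+1 then letters x (len x) ++ rword x else [::].

Fixpoint minwalk c v : 'S_n :=
  if c is x.+1 then minwalk x (row_walkp x (len x) (bumps len x.+1 (pos v) x) v)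
  else v.

Lemma feasible_valid c u : c <= k -> valid len c (pos (lowers (rword c) u)).
Proof.
elim: c u => [|x IHx] u lt_x; first by [].
rewrite /= lowers_cat; set y := lowers (rword x) u.
have [B ok e] := lowers_rowP y (len_lt lt_x).
apply: any_valid (ok) _ => [r lt_r|]; first by apply: len_mono => //; lia.
by rewrite -pos_row_walkp -?e ?len_lt //; apply: IHx; lia.
Qed.

Lemma lowers_minwalk c v : c <= k -> valid len c (pos v) ->
  lowers (rword c) (minwalk c v) = v.
Proof.
elim: c v => [|x IHx] v lt_x // val_v; rewrite /= lowers_cat.
have mono' r r' : r <= r' -> r' <= x -> len r <= len r'.
  by move=> le_r le_r'; apply: len_mono => //; lia.
rewrite IHx; [|lia|].
  by apply: lowers_row_walkp (min_row_ok val_v); apply: len_lt.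
by rewrite pos_row_walkp ?len_lt //; apply: min_valid => //; apply: pos_inj.
Qed.

(** Two walks with the same start separate after one row, so the induction compares different
    starting points and carries an inclusion of bumpable boxes. [any_bumps] gives the comparison
    within a row; [any_bumpable] followed by [min_bumpable] carries the inclusion to the next
    row. *)
Lemma minwalk_min c v u : c <= k -> valid len c (pos v) ->
  perm_le v (lowers (rword c) u) ->
  (forall r y, r < c -> bumpable len c (pos (lowers (rword c) u)) r y ->
     bumpable len c (pos v) r y) ->
  perm_le (minwalk c v) u.
Proof.
elim: c v u => [|x IHx] v u lt_x // val_v; rewrite /= lowers_cat.
set y := lowers (rword x) u; have [B ok e] := lowers_rowP y (len_lt lt_x).
set v' := lowers (letters _ _) y in ok e *; move=> le_v sub.
have mono r : r < x -> len r <= len x by move=> lt_r; apply: len_mono => //; lia.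
have mono' r r' : r <= r' -> r' <= x -> len r <= len r'.
  by move=> le_r le_r'; apply: len_mono => //; lia.
have injv := @pos_inj _ v.
have valy : valid len x (row_walk x (len x) B (pos v')).
  by rewrite -pos_row_walkp -?e ?len_lt //; apply: feasible_valid; lia.
apply: IHx; first by lia.
- by rewrite pos_row_walkp ?len_lt //; apply: min_valid.
- rewrite -/y e; apply: (row_walkp_mono _ (min_row_ok val_v) ok _ le_v); first exact: len_lt.
  move=> z z_in Bz; apply/asboolP; apply: sub => //.
  exact: (any_bumps ok valy z_in Bz).
- move=> r z lt_r; rewrite -/y e !pos_row_walkp ?len_lt // => bz.
  apply: min_bumpable => //; apply: sub; first by lia.
  exact: (any_bumpable mono ok lt_r bz).
Qed.

Lemma cross_valid x v : x < k -> valid len x.+1 (pos v) ->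
  row_ok x (len x) xpred0 (pos v) /\ valid len x (pos (row_walkp x (len x) xpred0 v)).
Proof.
move=> lt_x val_v; split.
  by apply/row_okP; split=> // y y_in; apply: val_v; lia.
move=> r y lt_r y_in; rewrite pos_row_walkp ?len_lt //.
have le_r : len r <= len x by apply: len_mono => //; lia.
rewrite row_out ?lt_r // -[y]/(y.+1.-1) row_cross //; last by lia.
by apply: val_v; lia.
Qed.

Lemma ell_push_rword c v : c <= k -> valid len c (pos v) ->
  ell (push (rword c) v) = size (rword c) + ell v.
Proof.
elim: c v => [|x IHx] v lt_x // val_v; rewrite /= push_cat size_cat.
have [ok val_x] := cross_valid lt_x val_v.
rewrite -row_walkp_cross IHx ?(ltnW lt_x) // ell_row_walkp_cross ?len_lt //.
by rewrite size_map size_iota addnCA addnA.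
Qed.

(** Both ends are mapped to [v], so monotonicity of [lowers] forces everything between them to be
    mapped to [v] as well. *)
Lemma fiber_interval v : valid len k (pos v) ->
  exists c, forall u,
    lowers (rword k) u = v <-> perm_le c u /\ perm_le u (push (rword k) v).
Proof.
move=> val_v; have [dn_m le_m] := push_fiber (ell_push_rword (leqnn k) val_v).
exists (minwalk k v) => u; split=> [e|[le_c le_u]].
  split; last by apply: le_m; rewrite e; apply: perm_le_refl.
  by apply: minwalk_min; rewrite ?e //; apply: perm_le_refl.
apply: perm_le_anti; first by rewrite -[X in perm_le _ X]dn_m; apply: lowers_mono.
by rewrite -[X in perm_le X _](lowers_minwalk (leqnn k) val_v); apply: lowers_mono.
Qed.

End Walks.

(** * Grassmannian permutations *)

Lemma omegaK n (s : 'S_n) : omega n ** (omega n ** s) = s.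
Proof.
by apply/permP=> i; rewrite /Defs.pcomp !permM !permE rev_ordK.
Qed.

Lemma pos_omega n (s : 'S_n) y : y < n -> pos (omega n ** s) y = pos s (n - y.+1).
Proof.
move=> lt_y; have lt_y' : n - y.+1 < n by lia.
rewrite (posE _ lt_y) (posE _ lt_y').
suff -> : ((omega n ** s)^-1)%g (Ordinal lt_y) = (s^-1)%g (Ordinal lt_y') by [].
apply: (@perm_inj _ (omega n ** s)); rewrite permKV /Defs.pcomp permM permKV.
by apply: val_inj; rewrite permE /=; lia.
Qed.

Lemma rank_count_pos_ge n (s : 'S_n) t q :
  n <= q -> rank_count (pos s) t q = rank_count id t q.
Proof.
move/subnKC<-; elim: (q - n) => [|d IHd]; last first.
  by rewrite addnS !rank_countS IHd pos_ge //; lia.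
rewrite addn0 /rank_count (reindex_inj (@perm_inj _ s)) /=.
by apply: eq_bigr => i _; rewrite pos_perm.
Qed.

Lemma rank_count_omega n (s : 'S_n) t q : q <= n ->
  rank_count (pos (omega n ** s)) t q + rank_count (pos s) t (n - q) = rank_count id t n.
Proof.
elim: q => [|q IHq] lt_q; first by rewrite subn0 {1}/rank_count big_ord0 rank_count_pos_ge.
rewrite rank_countS -IHq ?(ltnW lt_q) // pos_omega //.
have -> : n - q = (n - q.+1).+1 by lia.
by rewrite rank_countS; lia.
Qed.

(** By [rank_count_omega], complementary counts of [s] and [omega n ** s] add up to a number
    independent of [s], so the inequalities are reversed. *)
Lemma perm_le_omega n (s t : 'S_n) :
  perm_le (omega n ** s) (omega n ** t) <-> perm_le t s.
Proof.
suff H u v : perm_le v u -> perm_le (omega n ** u) (omega n ** v).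
  by split=> [/H|/H//]; rewrite !omegaK.
move=> le_vu a q; have [le_qn|lt_nq] := leqP q n; last by rewrite !rank_count_pos_ge // ltnW.
have := rank_count_omega u a le_qn; have := rank_count_omega v a le_qn.
have := le_vu a (n - q); lia.
Qed.

(** The inversions of [omega n ** u] are the non-inversions of [u], so each side counts all pairs of
    positions. *)
Lemma ell_omega n (s t : 'S_n) :
  ell (omega n ** s) + ell s = ell (omega n ** t) + ell t.
Proof.
suff H u : ell (omega n ** u) + ell u = #|[set p : 'I_n * 'I_n | p.1 < p.2]|.
  by rewrite !H.
rewrite -(cardsID [set p : 'I_n * 'I_n | u p.2 < u p.1]) addnC.
congr (_ + _); apply: eq_card => -[x y]; rewrite !inE //=.
rewrite /Defs.pcomp !permM !permE /= andbC.
case: (ltnP x y) => lt_xy; rewrite ?andbF // !andbT.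
have ne : u x != u y :> nat by rewrite val_eqE (inj_eq perm_inj) -val_eqE ltn_eqF.
have := ltn_ord (u x); have := ltn_ord (u y); lia.
Qed.

Section Zeta.
Variables (n : nat) (sigma : 'S_n) (k : nat).
Hypothesis le_kn : k <= n.

Let letters_ := [seq sigma i | i <- enum 'I_n].
Let geqo (a b : 'I_n) := b <= a.

Lemma size_zeta_half1 : size (sort geqo (take k letters_)) = k.
Proof. by rewrite size_sort size_takel // size_map size_enum_ord. Qed.

Lemma perm_zeta_word : perm_eq (zeta_word sigma k) letters_.
Proof. by rewrite -[X in perm_eq _ X](cat_take_drop k) perm_cat // perm_sort. Qed.

Lemma uniq_letters : uniq letters_.
Proof. by rewrite map_inj_uniq ?enum_uniq //; apply: perm_inj. Qed.

Lemma uniq_zeta_word : uniq (zeta_word sigma k).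
Proof. by rewrite (perm_uniq perm_zeta_word) uniq_letters. Qed.

Lemma size_zeta_word : size (zeta_word sigma k) = n.
Proof. by rewrite (perm_size perm_zeta_word) size_map size_enum_ord. Qed.

Lemma zetaE i : zeta sigma k i = nth i (zeta_word sigma k) i.
Proof. by rewrite permE. Qed.

(** Sorting stays within the blocks, so [zeta] and [sigma] have the same set of first [k]
    letters. *)
Lemma zeta_block i : ((zeta sigma k)^-1%g (sigma i) < k) = (i < k).
Proof.
set j := (zeta sigma k)^-1%g _; have ej : sigma i = zeta sigma k j by rewrite permKV.
have si : sigma i \in letters_ by apply: map_f; rewrite mem_enum.
have -> : (i < k) = (sigma i \in take k letters_).
  by rewrite in_take // index_map ?index_enum_ord //; apply: perm_inj.
have -> : (sigma i \in take k letters_) = (sigma i \in take k (zeta_word sigma k)).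
  by rewrite take_size_cat ?size_zeta_half1 // mem_sort.
rewrite in_take ?(perm_mem perm_zeta_word) // ej zetaE index_uniq //.
  by rewrite size_zeta_word.
exact: uniq_zeta_word.
Qed.

Lemma zeta_decr (i j : 'I_n) : i < j -> (j < k) || (k <= i) ->
  zeta sigma k j < zeta sigma k i.
Proof.
move=> lt_ij blk; have tr : transitive geqo by move=> a b c ? ?; apply: leq_trans; eassumption.
have tot : total geqo by move=> a b; apply: leq_total.
rewrite ltn_neqAle val_eqE (inj_eq perm_inj) -val_eqE gtn_eqF //=.
rewrite !zetaE (set_nth_default i j) ?size_zeta_word // /zeta_word -/letters_ -/geqo.
have sz2 : size (sort geqo (drop k letters_)) = n - k.
  by rewrite size_sort size_drop size_map size_enum_ord.
have := ltn_ord i; have := ltn_ord j; move=> lt_j lt_i.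
rewrite !nth_cat size_zeta_half1; case/orP: blk => [lt_jk|le_ki].
  rewrite lt_jk (ltn_trans lt_ij lt_jk).
  apply: (sorted_ltn_nth tr i (sort_sorted tot _)) => //;
    by rewrite inE size_zeta_half1; lia.
rewrite !ltnNge le_ki (leq_trans le_ki (ltnW lt_ij)) /=.
by apply: (sorted_ltn_nth tr i (sort_sorted tot _)); rewrite ?inE ?sz2; lia.
Qed.

End Zeta.

Section Grassmannian.
Variables (N k : nat).
Local Notation n := N.+2.
Hypothesis le_kn : k <= n.
Variable a : 'S_n.
Hypothesis a_incr : forall i j : 'I_n, i < j -> (j < k) || (k <= i) -> a i < a j.

Let aval r := pos a^-1%g r.
(** For [r < k] these are the parts, in increasing order, of the partition of the Grassmannian
    permutation [a]; by [aval_ge] the subtraction is not truncated there. *)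
Definition shift_len r := aval r - r.

Lemma aval_ord (i : 'I_n) : aval i = a i.
Proof. by rewrite /aval pos_ord invgK. Qed.

Lemma aval_incr r r' : r < r' -> r' < k -> aval r < aval r'.
Proof.
move=> lt_r lt_r'; have l1 : r < n by lia. have l2 : r' < n by lia.
have := @a_incr (Ordinal l1) (Ordinal l2) lt_r; rewrite /= lt_r' => /(_ isT).
by rewrite -!aval_ord.
Qed.

Lemma aval_ge r : r < k -> r <= aval r.
Proof.
elim: r => // r IHr lt_r; have := aval_incr (ltnSn r) lt_r.
by have := IHr (ltnW lt_r); lia.
Qed.

Lemma shift_lenE r : r < k -> r + shift_len r = aval r.
Proof. by move=> lt_r; rewrite subnKC // aval_ge. Qed.

Lemma shift_len_lt r : r < k -> r + shift_len r < n.
Proof. by move=> lt_r; rewrite shift_lenE // pos_lt //; lia. Qed.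

Lemma shift_len_leS r : r < r.+1 < k -> shift_len r <= shift_len r.+1.
Proof.
case/andP=> _ lt_r; have := shift_lenE lt_r; have := shift_lenE (ltnW lt_r).
by have := aval_incr (ltnSn r) lt_r; lia.
Qed.

Lemma shift_len_mono r r' : r <= r' -> r' < k -> shift_len r <= shift_len r'.
Proof.
move/subnKC<-; elim: (r' - r) => [|d IHd] lt_r'; first by rewrite addn0.
rewrite addnS in lt_r' *; apply: leq_trans (IHd (ltnW lt_r')) _.
by apply: shift_len_leS; lia.
Qed.

Lemma shift_len_valid (v : 'S_n) :
  (forall y, (pos v y < k) = (y < k)) -> valid shift_len k (pos v).
Proof.
move=> blk r y lt_r y_in; have := blk r; have := blk y; rewrite lt_r; lia.
Qed.

Lemma row_walk_end x l P : row_walk x l xpred0 P (x + l) = P x.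
Proof.
elim: l x P => [|l IHl] x P /=; first by rewrite addn0.
by rewrite addnS -addSn IHl; swapn_lia.
Qed.

(** Invariant of the walk without bumps from the identity, once the rows [k - 1] down to [c] are
    done. At [c = 0] it determines the end of the walk. *)
Definition row_inv c P : Prop :=
  [/\ forall y, y < c -> P y = y,
      forall r, c <= r < k -> P (r + shift_len r) = r &
      forall y z, y < z -> k <= P y -> k <= P z -> P y < P z].

Lemma row_inv_step x P : x < k -> row_inv x.+1 P ->
  row_inv x (row_walk x (shift_len x) xpred0 P).
Proof.
move=> lt_x [low done_ incr]; set P' := row_walk _ _ _ _; set l := shift_len x in P' *.
have P'end : P' (x + l) = x by rewrite /P' row_walk_end low.
have P'out y : (y < x) || (x + l < y) -> P' y = P y by move=> ?; rewrite /P' row_out.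
have P'in y : x <= y < x + l -> P' y = P y.+1.
  by move=> y_in; rewrite /P' -[y]/(y.+1.-1) row_cross //; lia.
split=> [y lt_y|r r_in|y z lt_yz].
- by rewrite P'out ?lt_y // low //; lia.
- have [<-//|ne] := eqVneq x r.
  have : shift_len x <= shift_len r by apply: shift_len_mono; lia.
  by rewrite -/l => le_l; rewrite P'out ?done_ //; lia.
have ney : y = x + l -> P' y < k by move=> ->; rewrite P'end.
have nez : z = x + l -> P' z < k by move=> ->; rewrite P'end.
(* [sh y] is the former place of the label now at [y]. It is increasing away from [x + l], where the
   carried label [x < k] now sits. *)
move=> ky kz; pose sh y := if x <= y < x + l then y.+1 else y.
have shE t : k <= P' t -> P' t = P (sh t).
  rewrite /sh; case: ifP => [/P'in//|nt kt]; rewrite P'out //.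
  have : t <> x + l by move=> e; move: kt; rewrite e P'end; lia.
  by lia.
have ey := shE _ ky; have ez := shE _ kz; rewrite ey ez.
rewrite ey in ky; rewrite ez in kz.
by apply: incr => //; rewrite /sh; do 2![case: ifP => ?]; lia.
Qed.

Lemma row_inv_push c (v : 'S_n) : c <= k -> valid shift_len c (pos v) -> row_inv c (pos v) ->
  row_inv 0 (pos (push (rword N shift_len c) v)).
Proof.
elim: c v => [|x IHx] v lt_x // val_v inv_v; rewrite /= push_cat -row_walkp_cross.
have [ok val_x] := cross_valid shift_len_mono shift_len_lt lt_x val_v.
apply: IHx => //; first exact: ltnW.
by rewrite pos_row_walkp ?shift_len_lt //; apply: row_inv_step.
Qed.

Lemma valid1 : valid shift_len k (pos (1 : 'S_n)%g).
Proof. by apply: shift_len_valid => y; rewrite pos1. Qed.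

(** By [row_inv 0] and the monotonicity of [a] on each block, [a^-1 ** a'] has no descent, so it is
    the identity. *)
Lemma push_grassmannian : push (rword N shift_len k) 1%g = a.
Proof.
set a' := push _ _.
have [_ rows cols] : row_inv 0 (pos a').
  apply: row_inv_push (leqnn k) valid1 _; split=> [y|r|y z]; rewrite ?pos1 //.
  by lia.
have rowa r : r < k -> pos a' (aval r) = r by move=> lt_r; rewrite -shift_lenE // rows.
have cola y : k <= y -> k <= pos a' (aval y).
  move=> le_y; rewrite leqNgt; apply/negP=> lt_k.
  have := rowa _ lt_k => /pos_inj; rewrite /aval => /pos_inj e.
  by move: lt_k; rewrite /aval e ltnNge le_y.
have posq y : pos (a^-1%g ** a') y = pos a' (aval y).
  have [lt_y|le_y] := ltnP y n; last by rewrite /aval !pos_ge.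
  rewrite /aval (posE _ lt_y) (posE a^-1%g lt_y) pos_ord /Defs.pcomp.
  by rewrite invMg permM.
suff e : a^-1%g ** a' = 1%g.
  by apply: (mulIg a^-1%g); rewrite mulgV -e.
apply: asc_all => i; rewrite /asc !posq.
have [lt_i|le_i] := ltnP i.+1 k; first by rewrite !rowa //; lia.
have [lt_i|le_i'] := ltnP i k.
  by rewrite rowa //; apply: leq_trans (cola _ le_i); lia.
apply: cols; rewrite ?cola //.
have := @a_incr (lo i) (hi i) (ltnSn _); rewrite le_i' orbT => /(_ isT).
by rewrite -!aval_ord.
Qed.

(** The word is reversed because [push] multiplies on the left, starting with the first letter. *)
Lemma rword_reduced : reduced a (rev (rword N shift_len k)).
Proof.
apply/reducedP; split.
  by rewrite -[RHS]push_grassmannian push_wprod /Defs.pcomp mul1g.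
rewrite size_rev -push_grassmannian (ell_push_rword shift_len_mono shift_len_lt) //.
  by rewrite ell1 addn0.
exact: valid1.
Qed.

End Grassmannian.

(** * Isobaric divided differences *)

Import GRing.Theory.
Local Open Scope ring_scope.

(** The exchanges are abstract ring morphisms of a field: once they are pushed down to [f], a
    rational identity in the images of [f] remains, which [field] decides. *)
Lemma divided_braid (F : fieldType) (t1 t2 : {rmorphism F -> F}) (x y z f : F) :
  x - y != 0 -> y - z != 0 -> x - z != 0 ->
  t1 x = y -> t1 y = x -> t1 z = z -> t2 x = x -> t2 y = z -> t2 z = y ->
  involutive t1 -> involutive t2 ->
  t1 (t2 (t1 f)) = t2 (t1 (t2 f)) ->
  let d1 g := (x * g - y * t1 g) / (x - y) in
  let d2 g := (y * g - z * t2 g) / (y - z) in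
  d1 (d2 (d1 f)) = d2 (d1 (d2 f)).
Proof.
move=> xy yz xz t1x t1y t1z t2x t2y t2z t1K t2K e /=.
have yx : y - x != 0 by rewrite -opprB oppr_eq0.
have zy : z - y != 0 by rewrite -opprB oppr_eq0.
have zx : z - x != 0 by rewrite -opprB oppr_eq0.
rewrite !(rmorphM, rmorphB, fmorphV, t1x, t1y, t1z, t2x, t2y, t2z, t1K, t2K) /=.
rewrite e; field.
by rewrite ?(xy, yz, xz, yx, zy, zx).
Qed.

Lemma divided_comm (F : fieldType) (t1 t2 : {rmorphism F -> F}) (x y z w f : F) :
  x - y != 0 -> z - w != 0 ->
  t1 z = z -> t1 w = w -> t2 x = x -> t2 y = y ->
  t1 (t2 f) = t2 (t1 f) ->
  let d1 g := (x * g - y * t1 g) / (x - y) in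
  let d2 g := (z * g - w * t2 g) / (z - w) in
  d1 (d2 f) = d2 (d1 f).
Proof.
move=> xy zw t1z t1w t2x t2y e /=.
rewrite !(rmorphM, rmorphB, fmorphV, t1z, t1w, t2x, t2y) /= e; field.
by rewrite ?(xy, zw).
Qed.

Lemma divided_idem (F : fieldType) (t : {rmorphism F -> F}) (x y f : F) :
  x - y != 0 -> t x = y -> t y = x -> involutive t ->
  let d g := (x * g - y * t g) / (x - y) in d (d f) = d f.
Proof.
move=> xy tx ty tK /=; have yx : y - x != 0 by rewrite -opprB oppr_eq0.
rewrite !(rmorphM, rmorphB, fmorphV, tx, ty, tK) /=; field.
by rewrite ?(xy, yx).
Qed.

Lemma frac_sub (F : fieldType) (a b c d : F) :
  b != 0 -> d != 0 -> a / b - c / d = (a * d - c * b) / (b * d).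
Proof. by move=> b0 d0; field; rewrite b0 d0. Qed.

Lemma divided_sub (F : fieldType) (x y f g f' g' : F) :
  (x * (f - g) - y * (f' - g')) / (x - y) =
  (x * f - y * f') / (x - y) - (x * g - y * g') / (x - y).
Proof. by rewrite -mulrBl; congr (_ / _); ring. Qed.

Lemma hat_comm_expand (F : fieldType) (a b c d : F) :
  a - b - (c - d) = a - c - (b - d).
Proof. by ring. Qed.

(** The two sides are the expanded triple products of [isobhat], with [a] the common triple product
    of [isob]; the differences [c - c] and [e - e] come from idempotence. *)
Lemma hat_braid_expand (F : fieldType) (a b c d e g : F) :
  a - b - (c - c) - (d - e - (c - g)) = a - d - (e - e) - (b - c - (e - g)).
Proof. by ring. Qed.

Section Operators.
Variables (K : idomainType) (n : nat).
Implicit Types (f g : xfrac K n) (i j : 'I_n.-1).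
Local Notation tof := (@FracField.tofrac {mpoly K[n]}).

Lemma xfracP f : exists p q, q != 0 /\ f = tof p / tof q.
Proof.
exists (frac (generic_quotient.repr f)).1, (frac (generic_quotient.repr f)).2.
by split; [apply: denom_ratioP | apply: frac_repr].
Qed.

Lemma msym_eq0 (s : 'S_n) (p : {mpoly K[n]}) : (msym s p == 0) = (p == 0).
Proof. by rewrite -[LHS](inj_eq (@inj_msym _ _ (s^-1)%g)) -msymMm mulgV msym1m msym0. Qed.

Lemma xswap_is_zmod i : zmod_morphism (xswap i : xfrac K n -> xfrac K n).
Proof.
move=> f g; have [p [q [q0 ->]]] := xfracP f; have [p' [q' [q0' ->]]] := xfracP g.
have q0f : tof q != 0 by rewrite tofrac_eq0.
have q0f' : tof q' != 0 by rewrite tofrac_eq0.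
have r0 : tof (msym (simple i) q) != 0 by rewrite tofrac_eq0 msym_eq0.
have r0' : tof (msym (simple i) q') != 0 by rewrite tofrac_eq0 msym_eq0.
have -> : tof p / tof q - tof p' / tof q' = tof (p * q' - p' * q) / tof (q * q').
  by rewrite tofracB !tofracM; exact: (@frac_sub (xfrac K n) _ _ _ _ q0f q0f').
rewrite (xswap_frac i (p * q' - p' * q)) ?mulf_neq0 //.
rewrite (xswap_frac i p) // (xswap_frac i p') //.
rewrite msymB !msymM.
rewrite tofracB !tofracM.
exact/esym/(@frac_sub (xfrac K n) _ _ _ _ r0 r0').
Qed.

Lemma xswap_is_monoid i : monoid_morphism (xswap i : xfrac K n -> xfrac K n).
Proof.
split=> [|f g].
  have -> : (1 : xfrac K n) = tof 1 / tof 1 by rewrite tofrac1 divr1.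
  by rewrite xswap_frac ?oner_eq0 // msym1.
have [p [q [q0 ->]]] := xfracP f; have [p' [q' [q0' ->]]] := xfracP g.
rewrite mulf_div -!tofracM !xswap_frac ?mulf_neq0 //.
by rewrite !msymM !tofracM mulf_div.
Qed.

HB.instance Definition _ i := GRing.isZmodMorphism.Build _ _ _ (@xswap_is_zmod i).
HB.instance Definition _ i := GRing.isMonoidMorphism.Build _ _ _ (@xswap_is_monoid i).

(** A relation allows any representative, so that identities between composed exchanges reduce to
    identities between permutations acting by [msym]. *)
Definition xrep f (pq : {mpoly K[n]} * {mpoly K[n]}) : Prop :=
  pq.2 != 0 /\ f = tof pq.1 / tof pq.2.

Lemma xrep_ex f : exists pq, xrep f pq.
Proof. by have [p [q [q0 e]]] := xfracP f; exists (p, q). Qed.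

Lemma xrep_swap i f pq :
  xrep f pq -> xrep (xswap i f) (msym (simple i) pq.1, msym (simple i) pq.2).
Proof. by case=> q0 ->; split; [rewrite msym_eq0 | rewrite (xswap_frac i pq.1 q0)]. Qed.

Lemma xrep_eq f g pq pq' : xrep f pq -> xrep g pq' -> pq = pq' -> f = g.
Proof. by move=> [_ ->] [_ ->] ->. Qed.

Lemma xswapK i : involutive (xswap i : xfrac K n -> xfrac K n).
Proof.
move=> f; have [[p q] r] := xrep_ex f.
apply: xrep_eq (xrep_swap i (xrep_swap i r)) r _.
by rewrite /= -!msymMm tperm2 !msym1m.
Qed.

Lemma simple_comm i j : (i.+1 < j)%N ->
  (simple j * simple i)%g = (simple i * simple j)%g.
Proof.
move=> lt_ij; apply: pos_eq => y; rewrite -!/(Defs.pcomp _ _).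
(* A trailing identity factor gives the products the shape expected by [pos_simple2]. *)
have e a b : a ** b = a ** (b ** 1%g) by rewrite /Defs.pcomp mul1g.
by rewrite e [in RHS]e !pos_simple2; swapn_lia.
Qed.

Lemma simple_braid i j : j = i.+1 :> nat ->
  (simple i * (simple j * simple i))%g = (simple j * (simple i * simple j))%g.
Proof.
move=> eij; apply: pos_eq => y; rewrite !mulgA -!/(Defs.pcomp _ _).
have e a b c : a ** (b ** c) = a ** (b ** (c ** 1%g)) :> 'S_n
  by rewrite /Defs.pcomp mul1g.
by rewrite e [in RHS]e !pos_simple3 eij; swapn_lia.
Qed.

Lemma xswap_comm i j f : (i.+1 < j)%N -> xswap i (xswap j f) = xswap j (xswap i f).
Proof.
move=> lt_ij; have [[p q] r] := xrep_ex f.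
apply: xrep_eq (xrep_swap i (xrep_swap j r)) (xrep_swap j (xrep_swap i r)) _.
by rewrite /= -!msymMm simple_comm.
Qed.

Lemma xswap_braid i j f : j = i.+1 :> nat ->
  xswap i (xswap j (xswap i f)) = xswap j (xswap i (xswap j f)).
Proof.
move=> e; have [[p q] r] := xrep_ex f.
apply: xrep_eq (xrep_swap i (xrep_swap j (xrep_swap i r)))
               (xrep_swap j (xrep_swap i (xrep_swap j r))) _.
by rewrite /= -!msymMm simple_braid.
Qed.

Lemma xswap_var i (l : 'I_n) : xswap i (xvar K l) = xvar K (simple i l).
Proof.
have -> : xvar K l = tof 'X_l / tof 1 by rewrite tofrac1 divr1.
rewrite xswap_frac ?oner_eq0 // msym1 tofrac1 divr1 /xvar msymX.
congr (tof 'X_[_]); apply/mnmP=> a; rewrite mnmE !mnmE.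
by rewrite -(inj_eq (@perm_inj _ (simple i))) permKV eq_sym.
Qed.

Lemma xvar_neq (a b : 'I_n) : a != b -> xvar K a - xvar K b != 0.
Proof.
move=> ne; rewrite /xvar subr_eq0 tofrac_eq; apply: contra ne => /eqP.
move/(congr1 (mcoeff U_(a))); rewrite !mcoeffX eqxx eq_mnm1 eq_sym.
by case: eqP => // _ /eqP; rewrite oner_eq0.
Qed.

Lemma lo_neq_hi i : lo i != hi i.
Proof. by rewrite -val_eqE /=; lia. Qed.

Lemma xswap_lo i : xswap i (xvar K (lo i)) = xvar K (hi i).
Proof. by rewrite xswap_var /simple tpermL. Qed.

Lemma xswap_hi i : xswap i (xvar K (hi i)) = xvar K (lo i).
Proof. by rewrite xswap_var /simple tpermR. Qed.

Lemma xswap_fix i (l : 'I_n) :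
  l != lo i -> l != hi i -> xswap i (xvar K l) = xvar K l.
Proof. by move=> ne1 ne2; rewrite xswap_var /simple tpermD // eq_sym. Qed.

Lemma isob_idem i f : isob i (isob i f) = isob i f.
Proof.
exact: (@divided_idem (xfrac K n) (xswap i) _ _ f (xvar_neq (lo_neq_hi i))
         (xswap_lo i) (xswap_hi i) (xswapK i)).
Qed.

Lemma isob_comm i j f : (i.+1 < j)%N -> isob i (isob j f) = isob j (isob i f).
Proof.
move=> lt_ij.
have f1 : xswap i (xvar K (lo j)) = xvar K (lo j).
  by apply: xswap_fix; rewrite -val_eqE /=; lia.
have f2 : xswap i (xvar K (hi j)) = xvar K (hi j).
  by apply: xswap_fix; rewrite -val_eqE /=; lia.
have f3 : xswap j (xvar K (lo i)) = xvar K (lo i).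
  by apply: xswap_fix; rewrite -val_eqE /=; lia.
have f4 : xswap j (xvar K (hi i)) = xvar K (hi i).
  by apply: xswap_fix; rewrite -val_eqE /=; lia.
exact: (@divided_comm (xfrac K n) (xswap i) (xswap j) _ _ _ _ f
  (xvar_neq (lo_neq_hi i)) (xvar_neq (lo_neq_hi j)) f1 f2 f3 f4 (xswap_comm f lt_ij)).
Qed.

Lemma isob_braid i j f : j = i.+1 :> nat ->
  isob i (isob j (isob i f)) = isob j (isob i (isob j f)).
Proof.
move=> e; have hl : lo j = hi i by apply: val_inj.
have yz : xvar K (hi i) - xvar K (hi j) != 0 by rewrite -hl xvar_neq ?lo_neq_hi.
have xz : xvar K (lo i) - xvar K (hi j) != 0.
  by apply: xvar_neq; rewrite -val_eqE /=; lia.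
have f1 : xswap i (xvar K (hi j)) = xvar K (hi j).
  by apply: xswap_fix; rewrite -val_eqE /=; lia.
have f2 : xswap j (xvar K (lo i)) = xvar K (lo i).
  by apply: xswap_fix; rewrite -val_eqE /=; lia.
have f3 : xswap j (xvar K (hi i)) = xvar K (hi j) by rewrite -hl xswap_lo.
have f4 : xswap j (xvar K (hi j)) = xvar K (hi i) by rewrite -hl xswap_hi.
rewrite /isob hl.
exact: (@divided_braid (xfrac K n) (xswap i) (xswap j) _ _ _ f
  (xvar_neq (lo_neq_hi i)) yz xz (xswap_lo i) (xswap_hi i) f1 f2 f3 f4
  (xswapK i) (xswapK j) (xswap_braid f e)).
Qed.

Lemma isob_braided : braided (@isob K n).
Proof. by split=> i j e f; [apply: isob_comm | apply: isob_braid]. Qed.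

Lemma isobB i : {morph @isob K n i : f g / f - g}.
Proof. move=> f g; by rewrite /isob rmorphB divided_sub. Qed.

Lemma isobhat_braided : braided (@isobhat K n).
Proof.
have [comm braid] := isob_braided; split=> i j e f; rewrite /isobhat !isobB.
  by rewrite comm // hat_comm_expand.
by rewrite !isob_idem braid // hat_braid_expand.
Qed.

End Operators.

(** * Expansion over a fiber *)

Section Expansion.
Variables (K : idomainType) (n : nat).
Implicit Types (f g : xfrac K n) (u v : 'S_n).

Lemma redword_reduced v : reduced v (redword v).
Proof. exact: projT2 (cid (exists_reduced v)). Qed.

Lemma pi_E v w f : reduced v w -> pi_ v f = act_word (@isob K n) w f.
Proof. by move=> rw; apply: matsumoto (isob_braided K n) (redword_reduced v) rw. Qed.

Lemma pihat_E v w f : reduced v w -> pihat_ v f = act_word (@isobhat K n) w f.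
Proof. by move=> rw; apply: matsumoto (isobhat_braided K n) (redword_reduced v) rw. Qed.

Lemma act_wordB (w : seq 'I_n.-1) : {morph (fun f => act_word (@isob K n) w f) : f g / f - g}.
Proof. by elim: w => //= i w IHw f g; rewrite isobB IHw. Qed.

(** This is the product rule of the 0-Hecke algebra: at a descent [v] has a reduced word starting
    with [i], and idempotence absorbs the extra letter. *)
Lemma pi_isob i v f : pi_ v (isob i f) = pi_ (raisep i v) f.
Proof.
rewrite /raisep; case: ifP => [ai|/negbT di].
  by rewrite (pi_E _ (reduced_asc ai (redword_reduced v))).
have [w rw] := exists_reduced (simple i ** v).
have rv := reduced_cons_desc di rw.
by rewrite !(pi_E _ rv) /= isob_idem.
Qed.

(** By [pi_isob], [isobhat i] followed by [pi_ v] is a difference of two terms at an ascent and zero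
    at a descent. This matches the fiber of [lowerp i] over [v], namely [v] and [simple i ** v], or
    nothing. Lengths are added in the exponent since only parity matters. *)
Lemma hecke_expansion (ws : seq 'I_n.-1) v f :
  pi_ v (act_word (@isobhat K n) (rev ws) f) =
  \sum_(u | lowers ws u == v) (-1) ^+ (size ws + ell v + ell u) * pi_ u f.
Proof.
elim: ws v => [|i ws IHws] v.
  by rewrite (big_pred1 v) // add0n addnn -mul2n exprM sqrrN !expr1n mul1r.
rewrite rev_cons -cats1 foldl_cat /=; set g := act_word _ _ _.
rewrite {1}/isobhat /pi_ act_wordB -!/(pi_ _ _) pi_isob {}/g.
rewrite /raisep; case: (boolP (asc i v)) => [av|dv]; last first.
  by rewrite subrr big_pred0 // => u; rewrite lowerp_eq (negbTE dv).
rewrite !IHws (ell_simple av) big_mkcond [X in _ - X]big_mkcond -sumrB.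
rewrite [RHS]big_mkcond /=; apply: eq_bigr => u _; rewrite lowerp_eq av /=.
have ne : v != simple i ** v.
  by apply/eqP => e; have := asc_simple i v; rewrite -e av.
case: (lowers ws u =P v) => [->|_] /=.
  by rewrite (negbTE ne) sub0r !addSn exprS mulN1r mulNr.
by case: ifP => _; rewrite subr0 // addnS.
Qed.

End Expansion.

Lemma sign_subn (R : pzRingType) a b : (b <= a)%N ->
  (-1) ^+ (a + b) = (-1) ^+ (a - b) :> R.
Proof.
move=> le_ba; rewrite -{1}(subnK le_ba) -addnA exprD addnn -mul2n exprM.
by rewrite sqrrN !expr1n mulr1.
Qed.

Lemma omegaE n (i : 'I_n) : omega n i = rev_ord i.
Proof. by rewrite permE. Qed.

Theorem theorem4p0p4 (n : nat) (hn : (2 <= n)%N) (sigma : 'S_n) (k : nat)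
    (hk : (1 <= k < n)%N) :
  exists eta : 'S_n,
    pi_ ((zeta sigma k)^-1%g ** sigma)
        (pihat_ (omega n ** zeta sigma k) (Gomega n))
    = \sum_(mu : 'S_n | `[< bruhat sigma mu /\ bruhat mu eta >])
        (-1) ^+ (ell mu - ell sigma)%N * G mu.
Proof.
case: n hn sigma hk => [//|[//|N]] _ sigma /andP[_ /ltnW le_kn].
set a := omega _ ** zeta sigma k; set b := _ ** sigma.
have a_incr (i j : 'I_N.+2) : (i < j)%N -> (j < k)%N || (k <= i)%N -> (a i < a j)%N.
  move=> lt_ij blk; have := zeta_decr sigma le_kn lt_ij blk.
  rewrite /a /Defs.pcomp !permM !omegaE /=.
  by have := ltn_ord (zeta sigma k i); lia.
have b_block y : (pos b y < k)%N = (y < k)%N.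
  have [lt_y|le_y] := ltnP y N.+2; last by rewrite pos_ge.
  rewrite (posE b lt_y); set i := (b^-1)%g _.
  have -> : y = b i by rewrite permKV.
  by rewrite -(zeta_block sigma le_kn i) /b /Defs.pcomp permM.
have val_b : valid (shift_len a) k (pos b) by apply: shift_len_valid.
pose ws := rword N (shift_len a) k.
have red_a : reduced a (rev ws) := rword_reduced le_kn a_incr.
have push_b : push ws b = omega _ ** sigma.
  rewrite push_wprod (proj1 red_a) /a /b /Defs.pcomp.
  by rewrite -mulgA (mulgA _ (zeta sigma k)) mulVg mul1g.
have mono := shift_len_mono le_kn a_incr; have ltn_ := shift_len_lt le_kn a_incr.
have [c fiberE] := fiber_interval mono ltn_ val_b.
have ell_b := ell_push_rword mono ltn_ (leqnn k) val_b.
(* [c] is the least element of the fiber; multiplication by [omega] reverses the order and makes it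
   the upper end. *)
exists (omega _ ** c); rewrite (pihat_E _ red_a) hecke_expansion.
rewrite [RHS](reindex_inj (can_inj (@omegaK N.+2))) /=.
apply: eq_big => [u|u /eqP/fiberE[_ le_u]].
  have le_sigma : perm_le sigma (omega _ ** u) <-> perm_le u (omega _ ** sigma).
    by rewrite -{1}(omegaK sigma) perm_le_omega.
  apply/eqP/asboolP; rewrite fiberE push_b !bruhatP perm_le_omega le_sigma.
    by case.
  by case.
rewrite /G omegaK -ell_b push_b; congr (_ * _).
have le_ell : (ell u <= ell (omega N.+2 ** sigma))%N.
  by rewrite -push_b; apply: bruhat_ell; apply/bruhatP.
rewrite sign_subn //; congr (_ ^+ _).
(* For [mu = omega ** u], the complement rule turns [ell mu - ell sigma] into
   [ell (omega ** sigma) - ell u]. *)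
have := ell_omega u (omega _ ** sigma); rewrite omegaK; lia.
Qed.
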